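(* Let $k$ be a field and $n\ge5$. A degree two class $D\in\operatorname{Pic}(\overline{\mathcal M}_{0,n})$ is an irreducible element of the monoid $M(\overline{\mathcal M}_{0,n})$ of effective classes if and only if $D=D_\Delta$ for a loop-free graph $\Delta$ on $[n-1]$ of one of the following types: (1) an $m$-gon with $m\ge6$ even; (2) an $m_1$-gon and an $m_2$-gon ($m_i\ge3$ odd) meeting in exactly one vertex; (3a) when $\operatorname{char}k=2$, a disjoint union of an $m_1$-gon and an $m_2$-gon with $m_i\ge3$ odd; (3b) when $\operatorname{char}k\ne2$, a vertex-disjoint $m_1$-gon and $m_2$-gon ($m_i\ge3$ odd) joined by a path of one or more edges whose internal vertices lie on neither polygon.
   Context: $\overline{\mathcal M}_{0,n}$ over $k$ with fixed Kapranov presentation $\overline{\mathcal M}_{0,n}\cong\operatorname{Bl}\mathbb P^{n-3}$; $\operatorname{Pic}=\mathbb ZH\oplus\bigoplus_I\mathbb ZE_I$ ($I\subseteq[n-1]$, $1\le|I|\le n-4$); the degree of a class is its $H$-coefficient. $M(\overline{\mathcal M}_{0,n})$ is the monoid of effective classes; an element is irreducible if nonzero and not a sum of two nonzero elements. A graph $\Delta$ on $[n-1]$ is identified with its set of edges; for such $\Delta$ (without loops), $D_\Delta=2H-\sum_I\big(2-\max_{e\in\Delta}|I\cap e|\big)E_I$. *)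

(* Defs.v *)
From HB Require Import structures.
From mathcomp Require Import all_boot all_order all_algebra.
Set Implicit Arguments. Unset Strict Implicit. Unset Printing Implicit Defensive.
Import Order.TTheory GRing.Theory Num.Theory.
Local Open Scope ring_scope.

(* Labels.  The paper's [n-1] = {1,...,n-1} is rendered as 'I_(n.-1)      *)
(* = {0,...,n-2} (label i+1 of the paper is the ordinal i).               *)

Definition EIdx (n : nat) :=
  {I : {set 'I_n.-1} | (0 < #|I|)%N && (#|I| <= n - 4)%N}.

(* Pic(M_{0,n}) = Z H ⊕ ⊕_I Z E_I ; a class D = d H - Σ_I a_I E_I is    *)
(* stored as the pair (d, a) (note the sign convention on a).            *)
Definition Pic (n : nat) := (int * {ffun EIdx n -> int})%type.

Definition pic0 (n : nat) : Pic n := (0, [ffun => 0]).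
Definition picAdd (n : nat) (D1 D2 : Pic n) : Pic n :=
  (D1.1 + D2.1, [ffun I => D1.2 I + D2.2 I]).

Definition picDeg (n : nat) (D : Pic n) : int := D.1.

(* Kapranov model: P^{n-3} with homogeneous coordinates x_0..x_{n-3}      *)
(* (n-2 of them); the n-1 blown-up points are p_i = e_i for i < n-2 and  *)
(* p_{n-2} = (1,...,1).  L_I = linear span of {p_i : i in I}.            *)
Definition kpt (n : nat) (i : 'I_n.-1) (j : 'I_(n - 2)) : nat :=
  if (val i < n - 2)%N then nat_of_bool (val i == val j) else 1%N.

(* Homogeneous polynomials of degree d in N variables over k: a          *)
(* coefficient for each exponent vector; only exponent vectors of total  *)
(* degree d are used.                                                    *)
Definition mono (N d : nat) := {ffun 'I_N -> 'I_d.+1}.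
Definition monoDeg (N d : nat) (m : mono N d) : nat := (\sum_j (m j : nat))%N.
Definition hpoly (k : fieldType) (N d : nat) := {ffun mono N d -> k}.

Definition hpoly_nonzero (k : fieldType) (N d : nat) (F : hpoly k N d) : bool :=
  [exists m : mono N d, (monoDeg m == d) && (F m != 0)].

Definition heval (k : fieldType) (N d : nat) (R : comNzRingType) (c : k -> R)
    (F : hpoly k N d) (x : 'I_N -> R) : R :=
  \sum_(m : mono N d | monoDeg m == d) c (F m) * \prod_j x j ^+ (m j : nat).

(* F vanishes to order >= a along L_I (for a <= 0 this is vacuous):      *)
(* for every commutative k-algebra B, every point x = Σ_{i in I} s_i p_i *)
(* of L_I with coordinates in B and every direction y in B^{n-2}, the    *)
(* polynomial F(x + t y) in B[t] is divisible by t^a.  (Equivalently all *)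
(* Hasse derivatives of F of order < a vanish on L_I, i.e. F ∈ I(L_I)^a.)*)
Definition vanishes_along (k : fieldType) (n d : nat) (F : hpoly k (n - 2) d)
    (I : {set 'I_n.-1}) (a : int) : Prop :=
  forall (B : comAlgType k) (s : 'I_n.-1 -> B) (y : 'I_(n - 2) -> B) (e : nat),
    (e%:Z < a) ->
    (heval (fun c : k => (c%:A : B)%:P) F
       (fun j => (\sum_(i in I) s i * (kpt i j)%:R)%:P + 'X * (y j)%:P))`_e = 0.

(* Effective classes of M_{0,n}bar = Bl P^{n-3} over k:                   *)
(* d H - Σ a_I E_I is effective iff there is a nonzero form F of degree d *)
(* over k with mult_{L_I}(F) >= a_I for all I.  (The divisor is then the  *)
(* strict transform of V(F) plus Σ (mult_{L_I} F - a_I) E_I.)            *)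
Definition effective (k : fieldType) (n : nat) (D : Pic n) : Prop :=
  exists (d : nat) (F : hpoly k (n - 2) d),
    [/\ D.1 = d%:Z, hpoly_nonzero F & forall I : EIdx n, vanishes_along F (val I) (D.2 I)].

Definition irreducible_eff (k : fieldType) (n : nat) (D : Pic n) : Prop :=
  [/\ effective k D, D <> pic0 n &
      forall D1 D2 : Pic n, effective k D1 -> effective k D2 ->
        D = picAdd D1 D2 -> D1 = pic0 n \/ D2 = pic0 n].

(* Graphs on [n-1], identified with their edge sets.                     *)
Definition graph (n : nat) := {set {set 'I_n.-1}}.

Definition loopfree (n : nat) (G : graph n) : Prop :=
  forall e, e \in G -> #|e| = 2%N.

Definition D_graph (n : nat) (G : graph n) : Pic n :=
  (2, [ffun I : EIdx n => 2%:Z - (\max_(e in G) #|val I :&: e|)%N%:Z]).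

Definition polygon (n : nat) (C : graph n) (V : {set 'I_n.-1}) (m : nat) : Prop :=
  (3 <= m)%N /\
  exists f : nat -> 'I_n.-1,
    [/\ ({in gtn m &, injective f}),
        V = [set f (val i) | i : 'I_m] &
        C = [set [set f (val i); f ((val i).+1 %% m)%N] | i : 'I_m]].

Definition type1 (n : nat) (G : graph n) : Prop :=
  exists (V : {set 'I_n.-1}) (m : nat), [/\ ~~ odd m, (6 <= m)%N & polygon G V m].

Definition type2 (n : nat) (G : graph n) : Prop :=
  exists (C1 C2 : graph n) (V1 V2 : {set 'I_n.-1}) (m1 m2 : nat),
    [/\ odd m1, odd m2, polygon C1 V1 m1 & polygon C2 V2 m2] /\
    #|V1 :&: V2| = 1%N /\ G = C1 :|: C2.

Definition type3a (n : nat) (G : graph n) : Prop :=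
  exists (C1 C2 : graph n) (V1 V2 : {set 'I_n.-1}) (m1 m2 : nat),
    [/\ odd m1, odd m2, polygon C1 V1 m1 & polygon C2 V2 m2] /\
    V1 :&: V2 = set0 /\ G = C1 :|: C2.

Definition type3b (n : nat) (G : graph n) : Prop :=
  exists (C1 C2 : graph n) (V1 V2 : {set 'I_n.-1}) (m1 m2 : nat),
    [/\ odd m1, odd m2, polygon C1 V1 m1 & polygon C2 V2 m2] /\
    V1 :&: V2 = set0 /\
    exists (l : nat) (g : nat -> 'I_n.-1),
      [/\ (1 <= l)%N, ({in gtn l.+1 &, injective g}), g 0%N \in V1 & g l \in V2] /\
      (forall i, (0 < i < l)%N -> g i \notin V1 :|: V2) /\
          G = C1 :|: C2 :|: [set [set g (val i); g (val i).+1] | i : 'I_l].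

(* Main.v *)
Require Import Defs.
From HB Require Import structures.
From mathcomp Require Import all_boot all_order all_algebra.
From mathcomp Require Import zify ring.
Set Implicit Arguments. Unset Strict Implicit. Unset Printing Implicit Defensive.
Import Order.TTheory GRing.Theory Num.Theory.
Local Open Scope ring_scope.

(** After changing the sign of the last one, the n - 1 Kapranov points sum to
    zero, so pulling a form on P^(n-3) back along (s_i) |-> sum_i s_i p_i gives a
    form in n - 1 variables invariant under translation by (1, ..., 1), and its
    multiplicity along L_I is the least degree of its monomials in the variables
    outside I. For quadrics the monomials are the edges and loops of a graph, and
    invariance says that the edge weights sum to zero, globally and around every
    vertex.

    Let D be irreducible of degree two, given by such a weighted graph. A loop or
    a square in the graph exhibits D as dominated by a sum of two hyperplane
    classes, so there is none. Otherwise a non-backtracking walk finds a graph of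
    the list inside the support: an odd cycle has either a third edge at some
    vertex, from which the walk closes up into an even cycle or a second odd
    cycle, or else is a component, which forces characteristic two and a second
    component. Alternating weights show that the listed D_Delta are effective,
    whence D = D_Delta. Conversely, the weights on a listed graph are unique up
    to a scalar and vanish nowhere, so D_Delta dominates no other effective class
    of degree two, and a sum of two hyperplane classes would produce a square. *)

(** * Forms given by terms in n - 1 variables *)

Section Forms.
Variables (k : fieldType) (n : nat).
Implicit Types (L : seq (k * seq 'I_n.-1)) (s : seq 'I_n.-1).

Definition termsum (R : comNzRingType) (c : k -> R) L (u : 'I_n.-1 -> R) : R :=
  \sum_(t <- L) c t.1 * \prod_(i <- t.2) u i.

(** A term is a coefficient with the list of its variables. A term of length [d] that contains the
    last index reaches only exponent vectors of degree below [d], which [heval] ignores; so this is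
    the restriction to u_last = 0. *)
Definition form_of_terms d L : hpoly k (n - 2) d :=
  [ffun m : mono (n - 2) d => \sum_(t <- L)
     t.1 *+ [forall j : 'I_(n - 2),
       (m j : nat) == count (fun i : 'I_n.-1 => val i == val j) t.2]].

Definition zero_ext (R : nzRingType) (x : 'I_(n - 2) -> R) (i : 'I_n.-1) : R :=
  if insub (val i) is Some j then x j else 0.

Lemma sum_count_val s :
  (\sum_(j < n - 2) count (fun i => val i == val j) s)%N
    = count (fun i => (val i < n - 2)%N) s.
Proof.
elim: s => [|i s IHs] /=; first by rewrite big1.
rewrite big_split /= IHs; congr (_ + _)%N.
case: ltnP => [lt_i|le_i].
  rewrite (bigD1 (Ordinal lt_i)) //= eqxx big1 ?addn0 // => j.
  by rewrite -val_eqE /= eq_sym => /negPf->.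
by rewrite big1 // => j _; case: eqP => // Ej; move: (ltn_ord j); rewrite -Ej ltnNge le_i.
Qed.

Lemma prod_count_val (R : comNzRingType) (x : 'I_(n - 2) -> R) s :
    all (fun i => (val i < n - 2)%N) s ->
  \prod_(j < n - 2) x j ^+ count (fun i => val i == val j) s
    = \prod_(i <- s) zero_ext x i.
Proof.
elim: s => [_|i s IHs /= /andP[lt_i /IHs {}IHs]].
  by rewrite big_nil big1.
rewrite big_cons -IHs /zero_ext insubT /=.
under eq_bigr do rewrite exprD.
rewrite big_split /=; congr (_ * _).
rewrite (bigD1 (Ordinal lt_i)) //= eqxx expr1 big1 ?mulr1 // => j.
by rewrite -val_eqE /= eq_sym => /negPf->.
Qed.

Lemma heval_form_of_terms d (R : comNzRingType) (c : {rmorphism k -> R}) L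
    (x : 'I_(n - 2) -> R) :
    all (fun t => size t.2 == d) L ->
  heval c (form_of_terms d L) x = termsum c L (zero_ext x).
Proof.
move=> /allP szL; rewrite /heval /termsum.
under eq_bigr do rewrite ffunE raddf_sum mulr_suml.
rewrite exchange_big /= big_seq [RHS]big_seq.
apply: eq_bigr => -[a s] /szL /= /eqP sz_s.
have count_le j : (count (fun i : 'I_n.-1 => val i == j) s < d.+1)%N.
  by rewrite ltnS -sz_s count_size.
have [all_lt|/allPn[i0 i0s ge_i0]] := boolP (all (fun i => (val i < n - 2)%N) s).
  pose m0 : mono (n - 2) d :=
    [ffun j => Ordinal (count_le (val j))].
  rewrite (bigD1 m0) /=; last first.
    rewrite /monoDeg; under eq_bigr do rewrite ffunE /=.
    by rewrite sum_count_val -sz_s -all_count.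
  case: forallP => [_|[]]; last by move=> j; rewrite ffunE.
  rewrite mulr1n; under eq_bigr do rewrite ffunE /=.
  rewrite prod_count_val // [X in _ + X]big1 ?addr0 // => m /andP[_ /eqP ne_m].
  case: forallP => [eq_m|]; last by rewrite mulr0n raddf0 mul0r.
  by case: ne_m; apply/ffunP=> j; apply/val_inj; rewrite ffunE /=; apply/eqP.
rewrite (big_rem i0) //= {1}/zero_ext insubF ?mul0r ?mulr0; last exact/negbTE.
rewrite big1 // => m /eqP deg_m; case: forallP => [eq_m|]; last by rewrite mulr0n raddf0 mul0r.
have: (count (fun i : 'I_n.-1 => (val i < n - 2)%N) s == size s).
  rewrite sz_s -sum_count_val -[X in _ == X]deg_m; apply/eqP.
  by apply: eq_bigr => j _; apply/esym/eqP.
by rewrite -all_count => /allP/(_ _ i0s); rewrite (negPf ge_i0).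
Qed.

(** Tested over polynomial rings over every [B], because [vanishes_along] evaluates forms there. *)
Definition translation_invariant L :=
  forall (B : comAlgType k) (u : 'I_n.-1 -> {poly B}) (t : {poly B}),
  termsum (polyC \o in_alg B) L (fun i => u i + t)
    = termsum (polyC \o in_alg B) L u.

Lemma prod_linear_coef0 (B : comNzRingType) (z : 'I_n.-1 -> {poly B})
    (P : pred 'I_n.-1) s e :
    (forall i, P i -> exists q, z i = 'X * q) ->
  (e < count P s)%N -> (\prod_(i <- s) z i)`_e = 0.
Proof.
move=> divX lt_e; suff [q ->] : exists q, \prod_(i <- s) z i = 'X^(count P s) * q.
  by rewrite coefXnM lt_e.
elim: s {lt_e} => [|i s [q IHs]] /=; first by exists 1; rewrite big_nil mulr1.
rewrite big_cons IHs; have [/divX[r ->]|_] := boolP (P i).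
  by exists (r * q); rewrite add1n exprS; ring.
by exists (z i * q); rewrite add0n; ring.
Qed.


Lemma lt_last (n_gt1 : (1 < n)%N) : (n - 2 < n.-1)%N. Proof. lia. Qed.
Lemma lt_sub2_pred (j : 'I_(n - 2)) : (val j < n.-1)%N.
Proof. by rewrite (leq_trans (ltn_ord j)) //; lia. Qed.

Definition last_pt (n_gt1 : (1 < n)%N) : 'I_n.-1 := Ordinal (lt_last n_gt1).
Definition coord_pt (j : 'I_(n - 2)) : 'I_n.-1 := Ordinal (lt_sub2_pred j).

(** Only the j-th coordinate point and (1, ..., 1) have a nonzero j-th coordinate. *)
Lemma sum_kpt (n_gt1 : (1 < n)%N) (R : nzRingType) (v : 'I_n.-1 -> R) j :
  \sum_i v i * (kpt i j)%:R = v (coord_pt j) + v (last_pt n_gt1).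
Proof.
have ne_last : last_pt n_gt1 != coord_pt j.
  by rewrite -val_eqE /=; have := ltn_ord j; lia.
rewrite (bigD1 (coord_pt j)) // (bigD1 (last_pt n_gt1)) //= big1 => [|i].
  by rewrite addr0 /kpt /= ltn_ord eqxx ltnn !mulr1.
rewrite -!val_eqE /kpt /= => /andP[/negPf-> ne_i].
have lt_i := ltn_ord i; case: ltnP => [_|ge_i]; rewrite ?mulr0 //. by exfalso; lia.
Qed.

Lemma eq_termsum (R : comNzRingType) (c : k -> R) L (u v : 'I_n.-1 -> R) :
  u =1 v -> termsum c L u = termsum c L v.
Proof. by move=> eq_uv; apply: eq_bigr => t _; congr (_ * _); apply: eq_bigr. Qed.

Lemma zero_ext_last (n_gt1 : (1 < n)%N) (R : nzRingType) (x : 'I_(n - 2) -> R) :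
  zero_ext x (last_pt n_gt1) = 0.
Proof. by rewrite /zero_ext insubF //= ltnn. Qed.

Lemma zero_ext_coord (R : nzRingType) (x : 'I_(n - 2) -> R) j :
  zero_ext x (coord_pt j) = x j.
Proof.
rewrite /zero_ext; case: insubP => [j' _ Ej|]; last by rewrite /= ltn_ord.
by rewrite (val_inj Ej : j' = j).
Qed.

Lemma pt_cases (n_gt1 : (1 < n)%N) (i : 'I_n.-1) :
  i = last_pt n_gt1 \/ exists j, i = coord_pt j.
Proof.
have [lt_i|ge_i] := ltnP i (n - 2); [right | left].
  by exists (Ordinal lt_i); apply: val_inj.
by apply: val_inj => /=; have := ltn_ord i; lia.
Qed.

Lemma heval_zero d (R : comNzRingType) (c : {rmorphism k -> R})
    (F : hpoly k (n - 2) d) x :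
  ~~ hpoly_nonzero F -> heval c F x = 0.
Proof.
move=> F0; rewrite /heval big1 // => m deg_m.
suff -> : F m = 0 by rewrite rmorph0 mul0r.
by apply/eqP/negP=> Fm; case/negP: F0; apply/existsP; exists m; rewrite deg_m; apply/negP.
Qed.

(* With signs, the n - 1 points sum to zero: a translation invariant form in
   n - 1 variables is determined by its restriction to u_last = 0, and that
   restriction is the form on the ambient space. *)
Lemma effective_of_terms d L (D : Pic n) :
    (1 < n)%N -> all (fun t => size t.2 == d) L -> translation_invariant L ->
    (exists u : 'I_n.-1 -> {poly k^o},
       termsum (polyC \o in_alg k^o) L u != 0) ->
    D.1 = d%:Z ->
    (forall (I : EIdx n) t, t \in L ->
       D.2 I <= (count (fun i => i \notin val I) t.2)%:Z) ->
  effective k D.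
Proof.
move=> n_gt1 szL invL [u nz_u] Dd leD; exists d, (form_of_terms d L).
split=> // [|I B s y e lt_e].
  (* Were the form zero, its pullback would be zero as well: translation by -u_last brings every [u]
     to a point whose last variable is zero. *)
  apply: contraR nz_u => /(heval_zero (polyC \o in_alg k^o)).
  move/(_ (fun j => u (coord_pt j) - u (last_pt n_gt1))).
  rewrite heval_form_of_terms // => Fu0.
  rewrite -(invL _ u (- u (last_pt n_gt1))) -[X in _ == X]Fu0.
  apply/eqP/eq_termsum => i.
  have [->|[j ->]] := pt_cases n_gt1 i; last by rewrite zero_ext_coord.
  by rewrite zero_ext_last subrr.
set x := fun j => _ + _.
pose sI i : B := if i \in val I then s i else 0.
(* The point of L_I displaced along [y], in the signed variables. The sign at the last index makes
   [x] the translate of [z] by -z_last. *)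
pose z i : {poly B} :=
  (if i == last_pt n_gt1 then - sI i else sI i)%:P
    + 'X * zero_ext (fun j => (y j)%:P) i.
have xz : zero_ext x =1 (fun i => z i - z (last_pt n_gt1)).
  move=> i; rewrite /z eqxx zero_ext_last mulr0 addr0.
  have [->|[j ->]] := pt_cases n_gt1 i.
    by rewrite eqxx !zero_ext_last mulr0 addr0 subrr.
  rewrite !zero_ext_coord -val_eqE /= ltn_eqF //.
  rewrite /x big_mkcond /= (eq_bigr (fun i => sI i * (kpt i j)%:R)) => [|i' _].
    by rewrite (sum_kpt n_gt1) polyCN opprK polyCD addrAC.
  by rewrite /sI; case: ifP; rewrite ?mul0r.
have := heval_form_of_terms (polyC \o in_alg B) x szL.
rewrite (eq_termsum _ _ xz) invL /= => ->.
(* By invariance the form is evaluated at [z], where every variable outside [I] is a multiple of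
   ['X]. *)
rewrite /termsum big_seq coef_sum big1 // => t tL.
rewrite /= coefCM (@prod_linear_coef0 _ _ [pred i | i \notin val I]) ?mulr0 //.
  move=> i /negPf I'i; exists (zero_ext (fun j => (y j)%:P) i).
  by rewrite /z /sI I'i oppr0 if_same polyC0 add0r.
by rewrite -ltz_nat (lt_le_trans lt_e) // leD.
Qed.

End Forms.

(** * Coefficients of effective classes of degree at most two *)

Section Monomials.
Variables (k : fieldType) (N d : nat).
Implicit Types m : mono N d.

(** Spelled out as the ordered list of its variables, a monomial of degree one or two can be treated
    by cases on that list. *)
Definition mono_seq m : seq 'I_N := flatten [seq nseq (m j) j | j <- enum 'I_N].

Lemma count_mono_seq m j : count_mem j (mono_seq m) = m j.
Proof.
rewrite count_flatten -map_comp sumnE big_map big_enum /= (bigD1 j) //=.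
rewrite count_nseq /= eqxx mul1n big1 ?addn0 // => i /negPf ne_ij.
by rewrite count_nseq /= ne_ij.
Qed.

Lemma mono_seq_inj : injective mono_seq.
Proof.
by move=> m1 m2 eq_m; apply/ffunP=> j; apply: val_inj; rewrite /= -!count_mono_seq eq_m.
Qed.

Lemma size_mono_seq m : size (mono_seq m) = monoDeg m.
Proof.
rewrite size_flatten /shape -map_comp sumnE big_map big_enum /=.
by apply: eq_bigr => j _; rewrite size_nseq.
Qed.

Lemma heval_mono_seq (R : comNzRingType) (c : k -> R) (F : hpoly k N d) x :
  heval c F x = \sum_(m : mono N d | monoDeg m == d) c (F m) * \prod_(j <- mono_seq m) x j.
Proof.
apply: eq_bigr => m _; rewrite big_flatten big_map big_enum /=; congr (_ * _).
by apply: eq_bigr => j _; rewrite big_nseq -Monoid.iteropE.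
Qed.

End Monomials.

Section Coefficients.
Variables (k : fieldType) (N : nat).

Lemma linear_form_coefs (F : hpoly k N 1) :
    hpoly_nonzero F ->
  exists2 M : 'I_N -> k, exists a, M a != 0 &
    forall (R : comNzRingType) (c : {rmorphism k -> R}) x,
      heval c F x = \sum_a c (M a) * x a.
Proof.
case/existsP=> m0 /andP[deg0 nz0].
pose M a := \sum_(m : mono N 1 | (monoDeg m == 1%N) && (mono_seq m == [:: a])) F m.
exists M.
  case Em0: (mono_seq m0) (size_mono_seq m0) => [|a [|b s]]; rewrite (eqP deg0) // => _.
  exists a; rewrite /M (bigD1 m0) ?deg0 ?Em0 ?eqxx //= big1 ?addr0 // => m.
  case/andP=> /andP[_ /eqP Em] /eqP ne_m.
  by case: ne_m; apply: mono_seq_inj; rewrite Em.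
move=> R c x; rewrite heval_mono_seq.
under [RHS]eq_bigr do rewrite rmorph_sum mulr_suml big_mkcondr.
rewrite [RHS]exchange_big; apply: eq_bigr => m /eqP deg_m.
case Em: (mono_seq m) (size_mono_seq m) => [|a [|b s]]; rewrite deg_m // => _.
rewrite -big_mkcond (bigD1 a) ?eqxx //= big_seq1 [X in _ + X]big1 ?addr0 //.
by move=> b /andP[/eqP[->]]; rewrite eqxx.
Qed.

(** Each monomial is recorded at one ordered pair only, so nothing is divided by two and
    characteristic two is covered. The coefficient of x_a x_b is [M a b + M b a]. *)
Lemma quadratic_form_coefs (F : hpoly k N 2) :
    hpoly_nonzero F ->
  exists2 M : 'I_N -> 'I_N -> k,
    exists a b, (if a == b then M a a else M a b + M b a) != 0 &
    forall (R : comNzRingType) (c : {rmorphism k -> R}) x,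
      heval c F x = \sum_a \sum_b c (M a b) * (x a * x b).
Proof.
case/existsP=> m0 /andP[deg0 nz0].
pose M a b := \sum_(m : mono N 2 | (monoDeg m == 2%N) && (mono_seq m == [:: a; b])) F m.
exists M.
  case Em0: (mono_seq m0) (size_mono_seq m0) => [|a [|b [|? s]]]; rewrite (eqP deg0) // => _.
  have Mab : M a b = F m0.
    rewrite /M (bigD1 m0) ?deg0 ?Em0 ?eqxx //= big1 ?addr0 // => m.
    case/andP=> /andP[_ /eqP Em] /eqP ne_m.
    by case: ne_m; apply: mono_seq_inj; rewrite Em.
  exists a, b; case: ifP => [/eqP Eab|/eqP ne_ab]; first by rewrite [X in M _ X]Eab Mab.
  rewrite Mab [M b a]big1 ?addr0 // => m /andP[_ /eqP Em].
  (* The swapped list has the same counts, hence comes from the same monomial, which forces a =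
     b. *)
  have Em_m0 : m = m0.
    apply/ffunP => j; apply: val_inj.
    by rewrite /= -!count_mono_seq Em Em0 /= addnCA.
  by move: Em; rewrite Em_m0 Em0 => -[].
move=> R c x; rewrite heval_mono_seq pair_big /=.
under [RHS]eq_bigr do rewrite rmorph_sum mulr_suml big_mkcondr.
rewrite [RHS]exchange_big; apply: eq_bigr => m /eqP deg_m.
case Em: (mono_seq m) (size_mono_seq m) => [|a [|b [|? s]]]; rewrite deg_m // => _.
rewrite -big_mkcond (bigD1 (a, b)) ?eqxx //= big_cons big_seq1 [X in _ + X]big1 ?addr0 //.
by case=> a' b' /andP[/eqP[-> ->]]; rewrite eqxx.
Qed.
End Coefficients.

(* A quadratic form in variables indexed by T is stored by its coefficients:
   that of x_i x_j at the edge {i, j}, that of x_i ^ 2 at the loop {i}. The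
   form is invariant under translation by (1, ..., 1) iff it is balanced. *)
Definition balanced (k : fieldType) (T : finType) (w : {set T} -> k) :=
  [/\ forall e, w e != 0 -> (0 < #|e| <= 2)%N,
      \sum_e w e = 0 &
      forall x, \sum_(e : {set T} | x \in e) w e + w [set x] = 0].

(* The degree of x_i x_j in the variables of I, for e = {i, j}. *)
Definition touch (T : finType) (e I : {set T}) : nat :=
  (e \subset I) + ~~ [disjoint e & I].

Section LowDegree.
Variables (k : fieldType) (n : nat) (n_gt1 : (1 < n)%N).
Local Notation V := 'I_n.-1.
Local Notation N := (n - 2)%N.

(** A nonzero constant vanishes nowhere. *)
Lemma effective_deg0 (D : Pic n) I : effective k D -> D.1 = 0 -> D.2 I <= 0.
Proof.
case=> d [F [Dd F0 vanF]]; rewrite Dd => -[d0]; subst d.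
rewrite leNgt; apply/negP=> gt0.
case/existsP: F0 => m /andP[deg_m]; apply/negP; rewrite negbK; apply/eqP.
have := vanF I k^o (fun=> 0) (fun=> 0) 0%N gt0.
rewrite /heval (bigD1 m) //= [X in _ + X]big1 => [|m' /andP[_ /eqP[]]]; last first.
  by apply/ffunP => j; rewrite !ord1.
rewrite addr0 big1 => [|j _]; last by rewrite ord1.
by rewrite mulr1 coefC /= -[_ *: _]/(_ * 1) mulr1.
Qed.

Definition sgn_pt (i : V) : k := if i == last_pt n_gt1 then -1 else 1.
Definition spt (i : V) (j : 'I_N) : k := sgn_pt i * (kpt i j)%:R.

Lemma sum_spt j : \sum_i spt i j = 0.
Proof.
rewrite (sum_kpt n_gt1) /sgn_pt eqxx -val_eqE /=.
by rewrite ltn_eqF // subrr.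
Qed.

Lemma spt_coord (a j : 'I_N) : spt (coord_pt a) j = (a == j)%:R.
Proof.
by rewrite /spt /sgn_pt /kpt -val_eqE /= ltn_eqF // mul1r ltn_ord -val_eqE.
Qed.

Definition span_pt (I : {set V}) (s : V -> k) (j : 'I_N) : k :=
  \sum_(i in I) s i * (kpt i j)%:R.

Lemma span_pt1 (I : {set V}) i :
  i \in I -> span_pt I (fun i' => sgn_pt i *+ (i' == i)) =1 spt i.
Proof.
move=> Ii j; rewrite /span_pt (bigD1 i) //= eqxx mulr1n big1 ?addr0 //.
by move=> i' /andP[_ /negPf->]; rewrite mul0r.
Qed.

Lemma span_ptD (I : {set V}) s1 s2 j :
  span_pt I (fun i => s1 i + s2 i) j = span_pt I s1 j + span_pt I s2 j.
Proof.
by rewrite /span_pt -big_split; apply: eq_bigr => i _; rewrite mulrDl.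
Qed.

(** The coefficients of 1 and t in F(x + t y) are F(x) and F(y). Testing over [k] itself is
    enough. *)
Lemma linear_vanishes (F : hpoly k N 1) (M : 'I_N -> k) I a :
    (forall (R : comNzRingType) (c : {rmorphism k -> R}) x,
       heval c F x = \sum_j c (M j) * x j) ->
    vanishes_along F I a ->
  (0 < a -> forall s, \sum_j M j * span_pt I s j = 0) /\
  (1 < a -> forall y, \sum_j M j * y j = 0).
Proof.
move=> FM van.
have co s y e : e%:Z < a -> (\sum_j (M j)%:P * ((span_pt I s j)%:P + 'X * (y j)%:P))`_e = 0.
  move=> lt_e; rewrite -[RHS](van k^o s y e lt_e).
  apply: (congr1 (fun p : {poly k^o} => p`_e)).
  apply: etrans (esym (FM _ (polyC \o in_alg k^o) _)).
  by apply: eq_bigr => j _; rewrite /= -[_ *: _]/(_ * 1) mulr1.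
have E s y : \sum_j (M j)%:P * ((span_pt I s j)%:P + 'X * (y j)%:P)
   = (\sum_j M j * span_pt I s j)%:P + (\sum_j M j * y j)%:P * 'X.
  rewrite !rmorph_sum mulr_suml -big_split; apply: eq_bigr => j _ /=.
  by rewrite !rmorphM; ring.
split=> lt_a => [s|y].
  by have := co s (fun=> 0) 0%N lt_a; rewrite E coefD coefMX !coefC /= addr0.
by have := co (fun=> 0) y 1%N lt_a; rewrite E coefD coefMX !coefC /= add0r.
Qed.

(** The values of a nonzero linear form at the signed points sum to zero and are not all zero, so
    two of them are nonzero. L_I lies in the hyperplane only if [I] avoids both of these points. *)
Lemma effective_deg1 (D : Pic n) :
    effective k D -> D.1 = 1 ->
  exists2 e : {set V}, #|e| = 2%N & forall I, D.2 I <= [disjoint e & val I]%:Z.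
Proof.
case=> d [F [Dd F0 vanF]]; rewrite Dd => -[d1]; subst d.
have [M [a Ma] FM] := linear_form_coefs F0.
pose l i := \sum_j M j * spt i j.
have sum_l : \sum_i l i = 0.
  rewrite exchange_big big1 // => j _.
  by rewrite -mulr_sumr sum_spt mulr0.
have la : l (coord_pt a) != 0.
  rewrite /l (bigD1 a) //= spt_coord eqxx mulr1 big1 ?addr0 // => j ne_j.
  by rewrite spt_coord eq_sym (negPf ne_j) mulr0.
have [b ne_b lb] : exists2 b, b != coord_pt a & l b != 0.
  apply/exists_inP; apply: contraNT la => /exists_inPn l0.
  move: sum_l; rewrite (bigD1 (coord_pt a)) //= big1 ?addr0 => [->//|i ne_i].
  by apply/eqP/negbNE/l0.
exists [set coord_pt a; b]; first by rewrite cards2 eq_sym ne_b.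
move=> I; have [van0 van1] := linear_vanishes FM (vanF I).
have lI i : i \in val I -> 0 < D.2 I -> l i = 0.
  move=> Ii gt0; rewrite -[RHS](van0 gt0 (fun i' => sgn_pt i *+ (i' == i))).
  by apply: eq_bigr => j _; rewrite span_pt1.
have le1 : D.2 I <= 1.
  by rewrite leNgt; apply: contra la => /van1 M0; rewrite /l M0.
case: (boolP [disjoint _ & _]) => [//|/pred0Pn[i /andP[/set2P Ei Ii]]].
rewrite leNgt; apply/negP => /(lI i Ii) /eqP.
by case: Ei => ->; apply/negP.
Qed.

(** Not symmetrised: the quadratic form is [bil M x x], and its polar form is
    [bil M x y + bil M y x]. *)
Definition bil (M : 'I_N -> 'I_N -> k) (x y : 'I_N -> k) : k :=
  \sum_a \sum_b M a b * (x a * y b).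

Lemma eq_bil M x x' y y' : x =1 x' -> y =1 y' -> bil M x y = bil M x' y'.
Proof.
move=> Ex Ey; apply: eq_bigr => a _; apply: eq_bigr => b _.
by rewrite Ex Ey.
Qed.

Lemma bilDl M x x' y : bil M (fun j => x j + x' j) y = bil M x y + bil M x' y.
Proof.
rewrite -big_split; apply: eq_bigr => a _; rewrite -big_split; apply: eq_bigr => b _ /=.
by ring.
Qed.

Lemma bilDr M x y y' : bil M x (fun j => y j + y' j) = bil M x y + bil M x y'.
Proof.
rewrite -big_split; apply: eq_bigr => a _; rewrite -big_split; apply: eq_bigr => b _ /=.
by ring.
Qed.

Lemma bil_sum_sptl M y : \sum_i bil M (spt i) y = 0.
Proof.
rewrite exchange_big big1 // => a _; rewrite exchange_big big1 // => b _.
by rewrite -mulr_sumr -mulr_suml sum_spt mul0r mulr0.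
Qed.

Lemma bil_sum_sptr M x : \sum_i bil M x (spt i) = 0.
Proof.
rewrite exchange_big big1 // => a _; rewrite exchange_big big1 // => b _.
by rewrite -2!mulr_sumr sum_spt !mulr0.
Qed.

(** The three conclusions read off the coefficients of 1, t and t^2 in F(x + t y): the value at x,
    the polar form, and the value at y. *)
Lemma quadratic_vanishes (F : hpoly k N 2) M I a :
    (forall (R : comNzRingType) (c : {rmorphism k -> R}) x,
       heval c F x = \sum_i \sum_j c (M i j) * (x i * x j)) ->
    vanishes_along F I a ->
  [/\ 0 < a -> forall s, bil M (span_pt I s) (span_pt I s) = 0,
      1 < a -> forall s y, bil M (span_pt I s) y + bil M y (span_pt I s) = 0 &
      2 < a -> forall y, bil M y y = 0].
Proof.
move=> FM van.
have co s y e : e%:Z < a ->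
    ((bil M (span_pt I s) (span_pt I s))%:P
     + ((bil M (span_pt I s) y + bil M y (span_pt I s))%:P
        + (bil M y y)%:P * 'X) * 'X)`_e = 0.
  move=> lt_e; rewrite -[RHS](van k^o s y e lt_e).
  apply: (congr1 (fun p : {poly k^o} => p`_e)).
  apply: etrans (esym (FM _ (polyC \o in_alg k^o) _)).
  rewrite -/(span_pt I s) [RHS](eq_bigr (fun i => \sum_j (M i j)%:P *
      (((span_pt I s i)%:P + 'X * (y i)%:P) * ((span_pt I s j)%:P + 'X * (y j)%:P)))).
    move: (span_pt I s) => x.
    rewrite !rmorphD !rmorph_sum mulr_suml -!big_split mulr_suml -big_split.
    apply: eq_bigr => i _ /=.
    rewrite !rmorph_sum mulr_suml -!big_split mulr_suml -big_split.
    by apply: eq_bigr => j _ /=; rewrite !rmorphM /=; ring.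
  move=> i _; apply: eq_bigr => j _.
  by rewrite /= -[_ *: _]/(_ * 1) mulr1.
split=> lt_a => [s|s y|y].
- by have := co s (fun=> 0) 0%N lt_a; rewrite coefD coefMX !coefC /= addr0.
- by have := co s y 1%N lt_a; rewrite coefD coefMX coefD coefMX !coefC /= add0r addr0.
by have := co (fun=> 0) y 2%N lt_a; rewrite coefD coefMX coefD coefMX !coefC /= !add0r.
Qed.

(** The weights are the coefficients of the form in the signed variables: its values at the points
    on loops, its polar form on edges. They are balanced because the signed points sum to zero. A
    nonzero coefficient bounds the multiplicity along L_I by its degree in the variables outside
    [I]. *)
Lemma effective_deg2 (D : Pic n) :
    effective k D -> D.1 = 2 ->
  exists2 w : {set V} -> k, balanced w /\ (exists e, w e != 0) &
    forall e (I : EIdx n), w e != 0 -> D.2 I <= 2 - (touch e (val I))%:Z.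
Proof.
case=> d [F [Dd F0 vanF]]; rewrite Dd => -[d2]; subst d.
have [M [a [b Mab]] FM] := quadratic_form_coefs F0.
pose W i j := bil M (spt i) (spt j).
(* Ordered pairs are grouped by their underlying set: an edge collects both orders, a loop only one
   pair. *)
pose w (e : {set V}) := \sum_(p : V * V | [set p.1; p.2] == e) W p.1 p.2.
have w1 i : w [set i] = W i i.
  rewrite /w (bigD1 (i, i)) /= ?setUid ?eqxx // big1 ?addr0 // => -[x y] /=.
  case/andP=> /eqP/setP Exy; have /set1P -> : x \in [set i] by rewrite -Exy set21.
  by have /set1P -> : y \in [set i]; rewrite ?eqxx // -Exy set22.
have w2 i j : i != j -> w [set i; j] = W i j + W j i.
  move=> ne_ij; rewrite /w (bigD1 (i, j)) //= (bigD1 (j, i)) /=; last first.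
    by rewrite setUC eqxx xpair_eqE eq_sym (negPf ne_ij).
  rewrite big1 ?addr0 // => -[x y] /= /andP[/andP[/eqP/setP Exy ne1 ne2]].
  have /set2P Ex : x \in [set i; j] by rewrite -Exy set21.
  have /set2P Ey : y \in [set i; j] by rewrite -Exy set22.
  case: Ex Ey ne1 ne2 Exy => -> [] ->; rewrite ?eqxx // => _ _ Exy.
    by have := Exy j; rewrite !inE eqxx orbT eq_sym (negPf ne_ij).
  by have := Exy i; rewrite !inE eqxx (negPf ne_ij).
have wE e : w e != 0 -> exists i j, e = [set i; j].
  move=> nz; have [p /eqP <-] : exists p : V * V, [set p.1; p.2] == e.
    apply/existsP; apply: contraNT nz => /existsPn no_p.
    by rewrite /w big1 // => p; rewrite (negPf (no_p p)).
  by exists p.1, p.2.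
have w_card e : w e != 0 -> (0 < #|e| <= 2)%N.
  by move=> /wE[i [j ->]]; rewrite cards2; case: eqP.
have total : \sum_e w e = 0.
  transitivity (\sum_(p : V * V) W p.1 p.2).
    by rewrite [RHS](partition_big (fun p : V * V => [set p.1; p.2]) predT).
  rewrite -(pair_big predT predT (fun i j => W i j)) /= big1 // => i _.
  exact: bil_sum_sptr.
have tension x : \sum_(e : {set V} | x \in e) w e + w [set x] = 0.
  have -> : \sum_(e : {set V} | x \in e) w e
      = \sum_(p : V * V | x \in [set p.1; p.2]) W p.1 p.2.
    rewrite [RHS](partition_big (fun p : V * V => [set p.1; p.2])
      (fun e : {set V} => x \in e)) //=; apply: eq_bigr => e xe.
    by apply: eq_bigl => p; case: eqP => [->|]; rewrite ?xe ?andbF.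
  rewrite w1.
  (* The pairs starting at [x] sum to zero. The remaining ones, completed by [W x x] from the loop,
     are the pairs ending at [x]. *)
  rewrite (bigID (fun p : V * V => p.1 == x)) /= -addrA.
  rewrite (eq_bigl (fun p : V * V => (p.1 == x) && true)); last first.
    by case=> i j /=; rewrite !inE ![x == _]eq_sym; case: eqP; rewrite ?andbF.
  rewrite -(pair_big (fun i => i == x) predT (fun i j => W i j)) /= big_pred1_eq.
  rewrite bil_sum_sptr add0r -[RHS](bil_sum_sptl M (spt x)) (bigD1 x) //= addrC.
  congr (_ + _).
  rewrite (eq_bigl (fun p : V * V => (p.1 != x) && (p.2 == x))); last first.
    case=> i j /=; rewrite !inE ![x == _]eq_sym.
    by do 2!case: eqP => //.
  rewrite -(pair_big (fun i => i != x) (fun i => i == x) (fun i j => W i j)) /=.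
  by apply: eq_bigr => i _; rewrite big_pred1_eq.
exists w; first split; [by [] | | ].
  have bil_coord i j : W (coord_pt i) (coord_pt j) = M i j.
    rewrite /W /bil (bigD1 i) //= (bigD1 j) //= !spt_coord !eqxx !mulr1.
    rewrite big1 => [|j' /negPf ne_j]; last by rewrite !spt_coord [j == _]eq_sym ne_j !mulr0.
    rewrite addr0 big1 ?addr0 // => i' /negPf ne_i; rewrite big1 // => j' _.
    by rewrite !spt_coord [i == _]eq_sym ne_i mul0r mulr0.
  exists [set coord_pt a; coord_pt b]; have [Eab|ne_ab] := eqVneq a b.
    by move: Mab; rewrite Eab eqxx setUid w1 bil_coord.
  by rewrite w2 ?bil_coord; [move: Mab; rewrite (negPf ne_ab) |].
move=> e I nz; have [van0 van1 van2] := quadratic_vanishes FM (vanF I).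
have le2 : D.2 I <= 2.
  rewrite leNgt; apply/negP=> /van2 M0; have [i [j Ee]] := wE _ nz.
  (* Polarization: the form vanishes at x, at y and at x + y. *)
  have MM x y : bil M x y + bil M y x = 0.
    have := M0 (fun j => x j + y j).
    by rewrite bilDl !bilDr !M0 addr0 add0r.
  case/eqP: nz; rewrite Ee; have [->|ne_ij] := eqVneq i j.
    by rewrite setUid w1 /W M0.
  by rewrite w2 //; apply: MM.
have W1 i : i \in val I -> 0 < D.2 I -> W i i = 0.
  move=> Ii gt0; rewrite -[RHS](van0 gt0 (fun i' => sgn_pt i *+ (i' == i))).
  by apply: eq_bil => j; rewrite span_pt1.
have W2 i j : i \in val I -> j \in val I -> 0 < D.2 I -> W i j + W j i = 0.
  move=> Ii Ij gt0.
  have := van0 gt0 (fun i' => sgn_pt i *+ (i' == i) + sgn_pt j *+ (i' == j)).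
  rewrite (@eq_bil _ _ (fun l => spt i l + spt j l) _ (fun l => spt i l + spt j l)).
  - by rewrite bilDl !bilDr -!/(W _ _) !W1 // addr0 add0r.
  - by move=> l; rewrite span_ptD !span_pt1.
  - by move=> l; rewrite span_ptD !span_pt1.
have W3 i j : i \in val I -> 1 < D.2 I -> W i j + W j i = 0.
  move=> Ii gt1; rewrite -[RHS](van1 gt1 (fun i' => sgn_pt i *+ (i' == i)) (spt j)).
  by congr (_ + _); apply: eq_bil => // l; rewrite span_pt1.
have [i [j Ee]] := wE _ nz.
have w0 i' j' : e = [set i'; j'] -> W i' i' = 0 -> W i' j' + W j' i' = 0 -> False.
  move=> Ee' Wi Wij; case/eqP: nz; rewrite Ee'.
  by have [->|ne_ij] := eqVneq j' i'; [rewrite setUid w1 | rewrite setUC w2 // addrC].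
rewrite /touch; case: (boolP (e \subset val I)) => [sub|_].
  have [Ii Ij] : i \in val I /\ j \in val I.
    by split; apply: (subsetP sub); rewrite Ee ?set21 ?set22.
  have [/pred0P dis|_] := boolP [disjoint _ & _].
    by have := dis i; rewrite /= Ii Ee set21.
  by rewrite leNgt; apply/negP => gt0; apply: (w0 i j) => //; [apply: W1 | apply: W2].
have [_|/pred0Pn[i' /andP[/= ei' Ii']]] := boolP [disjoint _ & _].
  by rewrite /= subr0.
have [j' Ee'] : exists j', e = [set i'; j'].
  move: ei'; rewrite Ee => /set2P[] ->; [by exists j | by exists i; rewrite setUC].
rewrite leNgt; apply/negP => gt1; apply: (w0 i' j') => //; last exact: W3.
by apply: W1 => //; apply: lt_trans gt1.
Qed.

End LowDegree.

(** * Cycles and non-backtracking walks *)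

Section Cycles.
Variable T : finType.
Implicit Types (s : seq T) (x y z : T).

Definition cyc_edges s : {set {set T}} := [set [set x; next s x] | x in s].

Lemma next_nth_mod x0 s i : uniq s -> (i < size s)%N ->
  next s (nth x0 s i) = nth x0 s (i.+1 %% size s).
Proof.
move=> Us lt_i; rewrite next_nth mem_nth //.
case: s Us lt_i => // y p Us lt_i; rewrite index_uniq //.
move: lt_i; rewrite ltnS leq_eqVlt => /predU1P[->|lt_i].
  by rewrite nth_default // modnn.
by rewrite modn_small //=; apply: set_nth_default.
Qed.

Lemma next_inj s : uniq s -> injective (next s).
Proof. by move=> Us; apply: can_inj (prev_next Us). Qed.

Lemma cyc_edges_nth x0 s : uniq s ->
  cyc_edges s =
    [set [set nth x0 s (val i); nth x0 s ((val i).+1 %% size s)] | i : 'I_(size s)].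
Proof.
move=> Us; apply/setP=> e; apply/imsetP/imsetP=> [[x xs ->]|[i _ ->]].
  have lt_i : (index x s < size s)%N by rewrite index_mem.
  by exists (Ordinal lt_i) => //=; rewrite -next_nth_mod ?nth_index.
by exists (nth x0 s i); rewrite ?mem_nth ?next_nth_mod.
Qed.

Lemma cyc_edges_rot i s : uniq s -> cyc_edges (rot i s) = cyc_edges s.
Proof.
move=> Us; apply/setP=> e; apply/imsetP/imsetP=> -[x xs ->]; exists x.
- by rewrite mem_rot in xs.
- by rewrite next_rot.
- by rewrite mem_rot.
by rewrite next_rot.
Qed.

Lemma cycle_cyc_edges s : uniq s ->
  cycle (fun x y => [set x; y] \in cyc_edges s) s.
Proof.
move=> Us; apply: (@sub_in_cycle _ (mem s) (frel (next s))); last exact: cycle_next.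
  by move=> x y xs _ /eqP <-; apply: imset_f.
exact/allP.
Qed.

Section Walks.
Variable e : rel T.
Hypotheses (e_sym : symmetric e) (e_irr : irreflexive e).
Hypothesis e_cont : forall x y, e x y -> exists2 z, z != y & e x z.

(** A walk leaving [x] outside [S] either enters [S] at [z], possibly at [x] itself, which closes a
    cycle of length at least three, or first meets its own track: a possibly empty tail [p] followed
    by a cycle avoiding [S]. *)
Variant lasso_spec (S : {pred T}) x : Prop :=
| LassoHit q z of path e x (rcons q z) & uniq (x :: q) & (forall v, v \in q -> v \notin S)
    & z \in S & q != [::] & (z == x -> (2 <= size q)%N)
| LassoLoop p c of path e x p & uniq (x :: p ++ c)
    & (forall v, v \in p ++ c -> v \notin S) & last x p \notin S
    & cycle e (last x p :: c) & (2 <= size c)%N.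

(** The current end of the walk is [l], and [q] lists the vertices strictly between [x] and [l]. By
    [e_cont] the walk can leave [l] without turning back; each step uses up a new vertex, so it must
    stop. *)
Lemma lasso_ext (S : {pred T}) m x q l : (#|T| - size q <= m)%N ->
    path e x (rcons q l) -> uniq (x :: rcons q l) ->
    (forall v, v \in rcons q l -> v \notin S) ->
  lasso_spec S x.
Proof.
elim: m => [|m IHm] in q l *.
  rewrite leqn0 subn_eq0 => sz _ Uq; have := max_card [in x :: rcons q l].
  by move/leq_trans/(_ sz); rewrite (card_uniqP Uq) /= size_rcons ltnNge leqnSn.
move=> sz Pq Uq Sq.
have e_l : e l (last x q) by move: Pq; rewrite rcons_path e_sym => /andP[].
have [z ne_z e_lz] := e_cont e_l.
have [Sz|nSz] := boolP (z \in S).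
  apply: (@LassoHit S x (rcons q l) z) => //.
  - by rewrite rcons_path Pq last_rcons.
  - by case: (q).
  - by move/eqP=> zx; rewrite size_rcons; case: (q) ne_z => //=; rewrite zx eqxx.
have [zq|nzq] := boolP (z \in x :: rcons q l); last first.
  apply: (IHm (rcons q l) z).
  - by rewrite size_rcons; move: sz; lia.
  - by rewrite rcons_path Pq last_rcons.
  - by rewrite -rcons_cons rcons_uniq nzq.
  - by move=> v; rewrite mem_rcons inE => /predU1P[->|/Sq].
have zxq : z \in x :: q.
  move: zq; rewrite -rcons_cons mem_rcons inE => /predU1P[zl|//].
  by rewrite zl e_irr in e_lz.
(* The walk has returned to [z]. The piece [p2] after [z] is nonempty because the last step did not
   turn back, so the cycle has at least three vertices. *)
have [p1 [p2 [Eq Ez]]] : exists p1 p2, q = p1 ++ p2 /\ z = last x p1.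
  by case/splitPl: zxq => p1 p2 <-; exists p1, p2.
subst q.
have p2n : p2 != [::].
  by apply: contraNneq ne_z => p20; rewrite Ez p20 cats0.
apply: (@LassoLoop S x p1 (rcons p2 l)).
- by move: Pq; rewrite rcons_cat cat_path => /andP[].
- by rewrite -rcons_cat.
- by move=> v; rewrite -rcons_cat => /Sq.
- by rewrite -Ez.
- rewrite /= rcons_path last_rcons -Ez e_lz andbT.
  by move: Pq; rewrite rcons_cat cat_path Ez => /andP[].
by rewrite size_rcons; case: (p2) p2n.
Qed.

Lemma lasso (S : {pred T}) x y : e x y -> y \notin S -> lasso_spec S x.
Proof.
move=> exy Sy; apply: (@lasso_ext S #|T| x [::] y); rewrite ?subn0 //=.
- by rewrite exy.
- by rewrite inE andbT; apply: contraTneq exy => ->; rewrite e_irr.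
by move=> v; rewrite inE => /eqP ->.
Qed.

Definition even_cycle := exists c, [/\ uniq c, cycle e c, ~~ odd (size c) & (4 <= size c)%N].

Lemma even_cycleI c :
  uniq c -> cycle e c -> ~~ odd (size c) -> (3 <= size c)%N -> even_cycle.
Proof.
move=> Uc Cc ev sz; exists c; split=> //.
by case: (size c) ev sz => [|[|[|[|m]]]].
Qed.

(* An ear between two vertices of an odd cycle closes up evenly with one of
   the two arcs. *)
Lemma ear_even_cycle s x z q : uniq s -> cycle e s -> odd (size s) ->
    x \in s -> z \in s -> x != z -> path e x (rcons q z) -> uniq q ->
    (forall v, v \in q -> v \notin s) ->
    (q == [::] -> [set x; z] \notin cyc_edges s) ->
  even_cycle.
Proof.
move=> Us Cs Os xs zs ne_xz Pq Uq qs q0.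
(* Rotated to start at [x], the cycle is cut by [z] into two arcs with interiors [s1] and [s2]. *)
have [i s' Er] := rot_to xs.
have Us' : uniq (x :: s') by rewrite -Er rot_uniq.
have Cs' : cycle e (x :: s') by rewrite -Er rot_cycle.
have Os' : odd (size (x :: s')) by rewrite -Er size_rot.
have Es' : cyc_edges s = cyc_edges (x :: s') by rewrite -Er cyc_edges_rot.
have qs' v : v \in q -> v \notin x :: s' by rewrite -Er mem_rot; apply: qs.
have zs' : z \in s'.
  by move: zs; rewrite -(mem_rot i) Er inE eq_sym (negPf ne_xz).
case/splitPr: zs' Us' Cs' Os' Es' qs' {Er} => s1 s2 Us' Cs' Os' Es' qs'.
have CE := cycle_cyc_edges Us'; rewrite -Es' in CE.
(* An ear without interior is a single edge off the cycle, so neither arc can be a single edge. *)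
have q0s1 : q = [::] -> s1 != [::].
  move=> /eqP/q0; apply: contraNneq => s10.
  by move: CE; rewrite s10 /= => /andP[].
have q0s2 : q = [::] -> s2 != [::].
  move=> /eqP/q0; apply: contraNneq => s20.
  by move: CE; rewrite s20 /= cats1 rcons_path last_rcons setUC => /andP[].
move: Us'; rewrite /= cat_uniq /= mem_cat inE !negb_or.
case/andP=> /and3P[xs1 _ xs2] /and4P[Us1 /andP[zs1 s12] zs2 Us2].
move: (Cs'); rewrite /= rcons_cat cat_path /= => /and3P[Ps1 e_s1z Ps2].
have xq : x \notin q by apply/negP=> /qs'; rewrite inE eqxx.
have zq : z \notin q by apply/negP=> /qs'; rewrite inE mem_cat inE eqxx !orbT.
(* The sizes of [s1] and [s2] have odd sum, so exactly one of them has the parity of the size of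
   [q]. *)
have [odd_s1|even_s1] := boolP (odd (size s1 + size q)).
  apply: (@even_cycleI (x :: q ++ z :: s2)).
  - rewrite /= cat_uniq mem_cat inE /= (negPf ne_xz) (negPf xq) (negPf xs2).
    rewrite Uq zs2 Us2 (negPf zq) /= andbT.
    apply/hasPn=> v vs2; apply/negP=> /qs'.
    by rewrite inE mem_cat inE vs2 !orbT.
  - by rewrite /= rcons_cat cat_path /=; move: Pq; rewrite rcons_path => /andP[-> ->].
  - move: Os' odd_s1; rewrite /= !size_cat /= !oddD /=.
    by do 3!case: (odd _).
  - rewrite /= size_cat /=; case: (q) q0s2 => [/(_ erefl)|? ? _] /=.
      by case: (s2).
    by rewrite addnS.
apply: (@even_cycleI (x :: s1 ++ z :: rev q)).
- rewrite /= cat_uniq mem_cat inE /= !mem_rev rev_uniq.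
  rewrite (negPf ne_xz) (negPf xs1) (negPf xq) Us1 (negPf zs1) zq Uq /= andbT.
  apply/hasPn=> v; rewrite mem_rev => /qs'.
  by rewrite inE mem_cat !negb_or => /and3P[].
- rewrite /= rcons_cat cat_path /= Ps1 e_s1z /=.
  have := rev_path e x (rcons q z); rewrite last_rcons belast_rcons rev_cons => ->.
  by rewrite (eq_path (e' := e)) // => ? ?; rewrite e_sym.
- move: Os' even_s1; rewrite /= !size_cat /= size_rev !oddD /=.
  by do 3!case: (odd _).
- rewrite /= size_cat /= size_rev; case: (q) q0s1 => [/(_ erefl)|? ? _] /=.
    by case: (s1) => //= ? ? _; rewrite addnS.
  by rewrite !addnS.
Qed.

End Walks.
End Cycles.

(** * Balanced edge weights *)

Lemma polygonP n (C : graph n) (V : {set 'I_n.-1}) m :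
  polygon C V m <->
  exists s : seq 'I_n.-1,
    [/\ uniq s, size s = m, (3 <= m)%N, V = [set x in s] & C = cyc_edges s].
Proof.
split=> [[m_ge3 [f [f_inj -> ->]]]|[s [Us <- m_ge3 -> ->]]].
  have Us : uniq (mkseq f m) by apply/mkseq_uniqP; exact: f_inj.
  exists (mkseq f m); split; rewrite ?size_mkseq //.
    apply/setP=> x; rewrite inE; apply/imsetP/mapP => [[i _ ->]|[i]].
      by exists (val i); rewrite ?mem_iota /= ?ltn_ord.
    by rewrite mem_iota => lt_i ->; exists (Ordinal lt_i).
  rewrite (cyc_edges_nth (f 0%N)) //.
  apply/setP=> e; apply/imsetP/imsetP=> [[i _ ->]|[[i lt_i] _ ->]].
    have lt_i : (i < size (mkseq f m))%N by rewrite size_mkseq.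
    by exists (Ordinal lt_i) => //=; rewrite size_mkseq !nth_mkseq ?ltn_pmod //; lia.
  have lt_im : (i < m)%N by rewrite size_mkseq in lt_i.
  by exists (Ordinal lt_im) => //=; rewrite size_mkseq !nth_mkseq ?ltn_pmod //; lia.
split=> //; case: s Us m_ge3 => // x0 s' Us m_ge3; set s := x0 :: s'.
exists (nth x0 s); split; last exact: cyc_edges_nth.
  by move=> i j; rewrite !inE => lt_i lt_j /eqP; rewrite nth_uniq // => /eqP.
apply/setP=> x; rewrite inE; apply/idP/imsetP => [/(nthP x0)[i lt_i <-]|[i _ ->]].
  by exists (Ordinal lt_i).
apply: mem_nth; exact: ltn_ord.
Qed.

Section Flows.
Variables (k : fieldType) (T : finType).
Implicit Types (w : {set T} -> k) (s : seq T).

(** Balanced weights without loops; no orientation is involved. In characteristic two it is the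
    global sum that excludes a lone odd cycle. *)
Definition flow w :=
  [/\ forall e, w e != 0 -> #|e| = 2%N, \sum_e w e = 0 &
      forall x, \sum_(e : {set T} | x \in e) w e = 0].

Lemma sum_incident w x (r : seq {set T}) : uniq r -> (forall e, e \in r -> x \in e) ->
    (forall e : {set T}, x \in e -> w e != 0 -> e \in r) ->
  \sum_(e : {set T} | x \in e) w e = \sum_(e <- r) w e.
Proof.
move=> Ur xr only; rewrite [RHS]big_uniq //= (bigID [in r]) /= [X in _ + X]big1 ?addr0.
  by apply: eq_bigl => e; apply: andb_idl; apply: xr.
by move=> e /andP[xe]; apply: contraNeq; apply: only.
Qed.

Lemma sum_two w x (a b : {set T}) : a != b -> x \in a -> x \in b ->
    (forall e : {set T}, x \in e -> w e != 0 -> e = a \/ e = b) ->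
  \sum_(e : {set T} | x \in e) w e = w a + w b.
Proof.
move=> ne_ab xa xb only.
rewrite (@sum_incident w x [:: a; b]) ?big_cons ?big_nil ?addr0 //.
- by rewrite /= inE ne_ab.
- by move=> e; rewrite !inE => /orP[] /eqP->.
by move=> e xe /(only e xe)[] ->; rewrite !inE eqxx ?orbT.
Qed.

Lemma next1_neq s x : uniq s -> (2 <= size s)%N -> x \in s -> next s x != x.
Proof.
move=> Us sz xs; rewrite -(nth_index x xs); have := xs; rewrite -index_mem => lt_i.
rewrite next_nth_mod // nth_uniq //; last by rewrite ltn_pmod //; lia.
move: lt_i; rewrite leq_eqVlt => /predU1P[Ei|lt_i].
  by rewrite Ei modnn eq_sym -lt0n -ltnS Ei.
by rewrite modn_small // gtn_eqF.
Qed.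

Lemma next2_neq s x : uniq s -> (3 <= size s)%N -> x \in s -> next s (next s x) != x.
Proof.
move=> Us sz xs; rewrite -(nth_index x xs); have := xs; rewrite -index_mem => lt_i.
have lt_mod j : (j %% size s < size s)%N by rewrite ltn_pmod //; lia.
rewrite !next_nth_mod // nth_uniq //.
move: lt_i; rewrite leq_eqVlt => /predU1P[Ei|lt_i].
  rewrite Ei modnn modn_small; last exact: ltnW.
  by rewrite neq_ltn -ltnS -[in X in _ || X]ltnS Ei sz.
rewrite (modn_small lt_i).
move: lt_i; rewrite leq_eqVlt => /predU1P[Ei|lt_i].
  by rewrite Ei modnn neq_ltn -2!ltnS Ei sz.
by rewrite modn_small // gtn_eqF.
Qed.

(** If two of these edges coincided, [next] would exchange their starting points, as in a cycle of
    length two. *)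
Lemma cyc_edge_inj s : uniq s -> (3 <= size s)%N ->
  {in s &, injective (fun x => [set x; next s x])}.
Proof.
move=> Us sz x y xs ys /setP Exy; apply/eqP/negPn/negP=> ne_xy.
have := Exy x; rewrite !inE eqxx (negPf ne_xy) /= => /esym/eqP Ex.
have := Exy y; rewrite !inE eqxx eq_sym (negPf ne_xy) /= => /eqP Ey.
by have := next2_neq Us sz xs; rewrite -Ey -Ex eqxx.
Qed.

Lemma cyc_edge_at s x e : uniq s -> e \in cyc_edges s -> next s x \in e ->
  e = [set x; next s x] \/ e = [set next s x; next s (next s x)].
Proof.
move=> Us /imsetP[y ys ->] /set2P[<-|/(next_inj Us) ->]; [by right | by left].
Qed.

(** The two edges at each vertex of positive index cancel. Nothing is asked at index 0, where
    further edges may be attached. *)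
Lemma cyc_edges_alternate w x0 s : uniq s -> (3 <= size s)%N ->
    (forall i, (0 < i < size s)%N ->
       \sum_(e : {set T} | nth x0 s i \in e) w e = 0) ->
    (forall i (e : {set T}), (0 < i < size s)%N -> nth x0 s i \in e ->
       w e != 0 -> e \in cyc_edges s) ->
  forall i, (i < size s)%N ->
    w [set nth x0 s i; next s (nth x0 s i)]
      = (-1) ^+ i * w [set nth x0 s 0; next s (nth x0 s 0)].
Proof.
move=> Us sz tens only; elim=> [|i IHi] lt_i; first by rewrite mul1r.
have lt_i' := ltnW lt_i; set u := nth x0 s i in IHi; set v := nth x0 s i.+1.
have Ev : v = next s u by rewrite next_nth_mod // modn_small.
have us : u \in s by apply: mem_nth.
have vs : v \in s by apply: mem_nth.
have := tens i.+1 lt_i; rewrite -/v.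
rewrite (@sum_two w v [set u; next s u] [set v; next s v]).
- by rewrite IHi // exprS mulN1r mulNr => /eqP; rewrite addrC addr_eq0 => /eqP.
- apply/eqP=> /(cyc_edge_inj Us sz us vs) /eqP.
  by rewrite Ev eq_sym (negPf (next1_neq Us _ us)) // ltnW.
- by rewrite -Ev set22.
- by rewrite set21.
move=> e ve nz; rewrite Ev; apply: cyc_edge_at => //; last by rewrite -Ev.
exact: (only i.+1).
Qed.

Lemma sum_cyc_edges w x0 s : uniq s -> (3 <= size s)%N ->
  \sum_(e in cyc_edges s) w e
    = \sum_(i < size s) w [set nth x0 s i; next s (nth x0 s i)].
Proof.
move=> Us sz; rewrite big_imset /=; last exact: cyc_edge_inj.
by rewrite -big_uniq //= (big_nth x0) big_mkord.
Qed.

Lemma sum_sign (R : nzRingType) m : \sum_(i < m) (-1) ^+ i = (odd m)%:R :> R.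
Proof.
elim: m => [|m IHm]; first by rewrite big_ord0.
rewrite big_ord_recr IHm -signr_odd oddS; case: odd; rewrite /= ?expr0 ?add0r //.
by rewrite expr1 subrr.
Qed.

End Flows.

(** * Listed subgraphs in the support of a flow *)

Definition listed_type (k : fieldType) n (G : graph n) : Prop :=
  [\/ type1 G, type2 G, (2%N \in [pchar k])%R /\ type3a G |
      (2%N \notin [pchar k])%R /\ type3b G].

Lemma polygon_cyc_edges n (s : seq 'I_n.-1) : uniq s -> (3 <= size s)%N ->
  polygon (cyc_edges s) [set x in s] (size s).
Proof. by move=> Us sz; apply/polygonP; exists s. Qed.

Section Subgraph.
Variables (k : fieldType) (n : nat) (w : {set 'I_n.-1} -> k).
Hypothesis w_flow : flow w.
Local Notation V := 'I_n.-1.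
Let adj : rel V := fun x y => w [set x; y] != 0.

Let adj_sym : symmetric adj.
Proof. by move=> x y; rewrite /adj setUC. Qed.

Let adj_irr : irreflexive adj.
Proof.
move=> x; apply/negbTE; rewrite /adj setUid negbK; apply/eqP.
case: w_flow => w2 _ _; apply/eqP; apply: contraTT isT => /w2.
by rewrite cards1.
Qed.

Lemma edge_other (e : {set V}) x : #|e| = 2%N -> x \in e -> exists2 y, y != x & e = [set x; y].
Proof.
move=> /eqP/cards2P[a [b [ne_ab ->]]] /set2P[->|->].
  by exists b; rewrite // eq_sym.
by exists a; rewrite // setUC.
Qed.

(** A vertex with a single edge of nonzero weight would have a nonzero sum. *)
Let adj_cont x y : adj x y -> exists2 z, z != y & adj x z.
Proof.
case: w_flow => w2 _ tens axy; apply/exists_inP; apply: contraTT isT => /exists_inPn no_z.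
have := tens x; rewrite (bigD1 [set x; y]) ?set21 //= big1 => [|e /andP[xe ne_e]].
  by rewrite addr0 => /eqP; rewrite (negPf (axy : _ != _)).
apply/eqP; apply: contraTT isT => nz.
have [z _ Ee] := edge_other (w2 _ nz) xe; rewrite {e}Ee in nz ne_e xe *.
have ne_zy : z != y by apply: contraNneq ne_e => ->.
by have := no_z z ne_zy; rewrite /adj nz.
Qed.

Let cyc_adj s : uniq s -> cycle adj s -> forall e, e \in cyc_edges s -> w e != 0.
Proof. by move=> Us Cs e /imsetP[x xs ->]; apply: (next_cycle Cs xs). Qed.

(** Quadrilaterals are kept apart from the longer even polygons: they split the class into two
    hyperplane classes. *)
Definition contains_square := exists a b c d : V,
  uniq [:: a; b; c; d] /\
  [/\ w [set a; b] != 0, w [set b; c] != 0, w [set c; d] != 0 & w [set d; a] != 0].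

Definition contains_listed := exists2 G : graph n,
  (forall e, e \in G -> w e != 0) & listed_type k G.

Let even_cycle_good : even_cycle adj -> contains_square \/ contains_listed.
Proof.
case=> c [Uc Cc ev sz]; have [sz4|sz5] := eqVneq (size c) 4; [left | right].
  case: c Uc Cc sz4 {ev sz} => [|a [|b [|c [|d [|]]]]] //= Uc /and5P[h1 h2 h3 h4 _] _.
  by exists a, b, c, d.
exists (cyc_edges c); first exact: cyc_adj.
constructor 1; exists [set x in c], (size c); split=> //.
  by case: (size c) ev sz sz5 => [|[|[|[|[|[|m]]]]]].
by apply: polygon_cyc_edges => //; apply: leq_trans sz.
Qed.

(** An even cycle already gives the conclusion, so a cycle may be assumed odd. *)
Let cycle_good c : uniq c -> cycle adj c -> (3 <= size c)%N ->
    (odd (size c) -> contains_square \/ contains_listed) ->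
  contains_square \/ contains_listed.
Proof.
move=> Uc Cc sz; case: (boolP (odd _)) => [_|ev _]; first exact.
by apply: even_cycle_good; apply: even_cycleI ev sz.
Qed.

Let disjoint_cycles s c : uniq s -> uniq c -> cycle adj s -> cycle adj c ->
    (3 <= size s)%N -> (3 <= size c)%N -> odd (size s) -> odd (size c) ->
    (forall v, v \in c -> v \notin s) -> 2%N \in [pchar k] -> contains_listed.
Proof.
move=> Us Uc Cs Cc szs szc os oc dis char2.
exists (cyc_edges s :|: cyc_edges c).
  by move=> e /setUP[]; apply: cyc_adj.
constructor 3; split=> //.
exists (cyc_edges s), (cyc_edges c), [set x in s], [set x in c], (size s), (size c).
split; first by split=> //; apply: polygon_cyc_edges.
split=> //; apply/setP=> v; rewrite !inE.
by apply/negbTE; rewrite negb_and; case: (boolP (v \in c)) => [/dis->|]; rewrite ?orbT.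
Qed.

(** In characteristic two the path is dropped and the two disjoint odd cycles suffice; otherwise the
    path is part of the graph. The second cycle is [last x p :: c], hence the even size of [c]. *)
Let joined_cycles s c x p : uniq s -> cycle adj s -> cycle adj (last x p :: c) ->
    (3 <= size s)%N -> (2 <= size c)%N -> odd (size s) -> ~~ odd (size c) ->
    x \in s -> path adj x p -> uniq (x :: p ++ c) ->
    (forall v, v \in p ++ c -> v \notin s) -> last x p \notin s ->
  contains_listed.
Proof.
move=> Us Cs Cc szs szc os oc xs Pp Upc dis last_s; set z := last x p.
have pn : (0 < size p)%N by case: (p) last_s => //=; rewrite xs.
have zp : z \in p by rewrite /z; case: (p) pn => //= y p' _; apply: mem_last.
move: Upc; rewrite -cat_cons cat_uniq => /and3P[Uxp Dpc Uc].
have Uzc : uniq (z :: c).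
  rewrite /= Uc andbT; apply: contra Dpc => zc.
  by apply/hasP; exists z; rewrite // inE zp orbT.
have dis_zc v : v \in z :: c -> v \notin s.
  by rewrite inE => /predU1P[->//|vc]; apply: dis; rewrite mem_cat vc orbT.
have [char2|char2] := boolP (2%N \in [pchar k]).
  exact: (@disjoint_cycles s (z :: c)).
exists (cyc_edges s :|: cyc_edges (z :: c) :|:
   [set [set nth x (x :: p) (val i); nth x (x :: p) (val i).+1] | i : 'I_(size p)]).
  move=> e /setUP[/setUP[]|/imsetP[i _ ->]]; try exact: cyc_adj.
  exact: (elimT (pathP x) Pp _ (ltn_ord i)).
constructor 4; split=> //.
exists (cyc_edges s), (cyc_edges (z :: c)), [set v in s], [set v in z :: c].
exists (size s), (size (z :: c)).
split; first by split=> //; apply: polygon_cyc_edges.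
split.
  apply/setP=> v; rewrite inE [v \in set0]inE !(inE, in_cons) -in_cons.
  apply/negbTE; rewrite negb_and.
  by case: (boolP (v \in z :: c)) => [/dis_zc->//|]; rewrite orbT.
exists (size p), (nth x (x :: p)); split.
  split=> //; first by move=> i j; rewrite !inE => li lj /eqP; rewrite nth_uniq // => /eqP.
    by rewrite inE.
  by rewrite -last_nth -/z !inE eqxx.
split=> // i /andP[i0 ip].
have ip' : nth x (x :: p) i \in p.
  by case: i i0 ip => //= i _ ip; apply: mem_nth; apply: ltnW.
rewrite !inE !negb_or dis ?mem_cat ?ip' //=; apply/andP; split.
  rewrite /z (last_nth x) nth_uniq //= ?ltnS //; first by rewrite ltn_eqF.
  exact: ltnW.
apply: contra Dpc => ic; apply/hasP; exists (nth x (x :: p) i) => //.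
by rewrite inE ip' orbT.
Qed.

Lemma flow_subgraph : (exists e, w e != 0) -> contains_square \/ contains_listed.
Proof.
case: (w_flow) => w2 total tens [e0 nz0].
have [x0 [y0 [a0 Ee0]]] : exists x y, adj x y /\ e0 = [set x; y].
  have /eqP/cards2P[x [y [_ Ee]]] := w2 _ nz0.
  by exists x, y; rewrite /adj -Ee.
(* With nothing to hit, the walk must close up, which gives a first cycle. *)
have [//|p c _ Upc _ _ Cs szc] := @lasso _ adj adj_sym adj_irr adj_cont pred0 x0 y0 a0 isT.
set s := last x0 p :: c in Cs.
have Us : uniq s.
  move: Upc; rewrite -cat_cons lastI cat_rcons cat_uniq.
  by case/and3P.
have szs : (3 <= size s)%N by [].
apply: (@cycle_good s) => // os; clearbody s; clear p c Upc szc Ee0 e0 nz0 a0 x0 y0.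
(* Either some edge of the support other than a cycle edge starts at a vertex [x] of the odd cycle,
   or the cycle is a component of the support. *)
have [/existsP[x /existsP[y /and3P[xs axy nC]]]|/existsPn no3] :=
  boolP [exists x, exists y, [&& x \in s, adj x y & [set x; y] \notin cyc_edges s]].
  have ne_xy : x != y by apply: contraTneq axy => ->; rewrite adj_irr.
  have [ys|nys] := boolP (y \in s).
    (* A chord is an ear without interior vertices. *)
    apply: even_cycle_good.
    by apply: (@ear_even_cycle _ adj adj_sym s x y [::]); rewrite //= axy.
  (* The walk returns to the cycle at another vertex, giving an ear; or at [x], giving a second
     cycle that meets the first only in [x]; or it closes up outside, giving a disjoint cycle joined
     to the first by a path. *)
  have [q z Pq Uq qs zs qn zx|p c Pp Upc dis ls Cc szc] :=
      @lasso _ adj adj_sym adj_irr adj_cont [in s] x y axy nys.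
    move: (Uq) => /= /andP[xq Uq'].
    have [Ezx|ne_zx] := eqVneq z x; last first.
      apply: even_cycle_good.
      by apply: (@ear_even_cycle _ adj adj_sym s x z q) => //;
        [rewrite eq_sym | rewrite (negPf qn)].
    have Cq : cycle adj (x :: q) by rewrite /= -{2}Ezx.
    have szq : (3 <= size (x :: q))%N by apply: zx; apply/eqP.
    apply: (@cycle_good (x :: q)) => // oq; right.
    exists (cyc_edges s :|: cyc_edges (x :: q)).
      by move=> e /setUP[]; apply: cyc_adj.
    constructor 2.
    exists (cyc_edges s), (cyc_edges (x :: q)), [set v in s], [set v in x :: q].
    exists (size s), (size (x :: q)).
    split; first by split=> //; apply: polygon_cyc_edges.
    split=> //; rewrite -(cards1 x); congr #|pred_of_set _|; apply/setP=> v; rewrite !inE.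
    by case: eqVneq => [->|_]; rewrite ?xs //=; apply/negbTE; rewrite negb_and orbC;
      case: (boolP (v \in q)) => //= /qs.
  have Uc : uniq (last x p :: c).
    by move: Upc; rewrite -cat_cons lastI cat_rcons cat_uniq => /and3P[].
  apply: (@cycle_good (last x p :: c)) => // oc; right.
  by apply: (@joined_cycles s c x p).
have only x (e : {set V}) : x \in s -> x \in e -> w e != 0 -> e \in cyc_edges s.
  move=> xs xe nz; have [y _ Ee] := edge_other (w2 _ nz) xe.
  have := existsPn (no3 x) y; rewrite xs /adj -Ee nz /=.
  by rewrite negbK.
have x1 : 'I_n.-1 by case: (s) szs.
have mem_s i : (i < size s)%N -> nth x1 s i \in s by apply: mem_nth.
have szs0 : (0 < size s)%N by apply: leq_trans szs.
have alt := @cyc_edges_alternate k _ w x1 s Us szs (fun i _ => tens _)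
  (fun i e lti => only _ e (mem_s i (proj2 (andP lti)))).
set a := w [set nth x1 s 0; next s (nth x1 s 0)] in alt.
have a_n0 : a != 0 by apply: (cyc_adj Us Cs); apply: imset_f; apply: mem_s.
set u := nth x1 s (size s).-1.
have us : u \in s by apply: mem_s; rewrite prednK.
have Eu : next s u = nth x1 s 0 by rewrite next_nth_mod ?prednK // modnn.
(* The first and the last edge of the odd cycle both have weight [a] and meet at its vertex of index
   0, so 2 a = 0. *)
have := tens (next s u); rewrite (@sum_two k _ w _ [set u; next s u]
  [set next s u; next s (next s u)]).
- rewrite {2 3}Eu -/a alt ?prednK // -signr_odd.
  have -> : odd (size s).-1 = false by case: (size s) os szs0 => //= m /negbTE.
  rewrite mul1r -mulr2n -mulr_natl => /eqP; rewrite mulf_eq0 (negPf a_n0) orbF => two0.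
  have char2 : 2%N \in [pchar k] by rewrite inE.
  (* The alternating weights on the odd cycle sum to [a], so the vanishing total requires an edge
     elsewhere. *)
  have [e nz nC] : exists2 e, w e != 0 & e \notin cyc_edges s.
    apply/exists_inP; apply: contraNT a_n0 => /exists_inPn all_C.
    have := total; rewrite (bigID [in cyc_edges s]) /= [X in _ + X]big1 ?addr0.
      rewrite (sum_cyc_edges w x1 Us szs) (eq_bigr (fun i : 'I_(size s) => (-1) ^+ i * a)).
        by rewrite -mulr_suml sum_sign os mul1r => ->.
      by move=> i _; apply: alt.
    by move=> e nC; apply/eqP; apply: contraNT nC => /all_C; rewrite negbK.
  have /eqP/cards2P[x [y [_ Ee]]] := w2 _ nz.
  have nxs : x \notin s.
    by apply: contra nC => xs; apply: (only x) => //; rewrite Ee set21.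
  have nys : y \notin s.
    by apply: contra nC => ys; apply: (only y) => //; rewrite Ee set22.
  have axy : adj x y by rewrite /adj -Ee.
  (* Since the first cycle is a component, the walk cannot enter it and closes up outside. *)
  have [q z Pq _ qs zs qn _|p c Pp Upc dis ls Cc szc] :=
      @lasso _ adj adj_sym adj_irr adj_cont [in s] x y axy nys.
    have lq : last x q \in q by case: (q) qn => //= v q' _; apply: mem_last.
    have : adj (last x q) z by move: Pq; rewrite rcons_path => /andP[].
    move/(only z _ zs (set22 _ _)) => /imsetP[v vs Ev].
    have : last x q \in [set v; next s v] by rewrite -Ev set21.
    case/set2P=> El; have := qs _ lq; rewrite El ?vs //.
    by rewrite ?(mem_next, vs).
  have Uc : uniq (last x p :: c).
    by move: Upc; rewrite -cat_cons lastI cat_rcons cat_uniq => /and3P[].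
  apply: (@cycle_good (last x p :: c)) => // oc; right.
  apply: (@disjoint_cycles s (last x p :: c)) => // v.
  by rewrite inE => /predU1P[->//|vc]; apply: dis; rewrite mem_cat vc orbT.
- apply/eqP=> /(cyc_edge_inj Us szs us) Euu.
  by case/eqP: (next1_neq Us (ltnW szs) us); apply/esym/Euu; rewrite mem_next.
- by rewrite set22.
- by rewrite set21.
move=> e ve nz; apply: cyc_edge_at => //; apply: only ve nz.
by rewrite mem_next.
Qed.

End Subgraph.

(** * Alternating weights on the listed graphs *)

Section Effective.
Variables (k : fieldType) (n : nat) (n_gt1 : (1 < n)%N).
Local Notation V := 'I_n.-1.

Lemma effective_deg0I (D : Pic n) : D.1 = 0 -> (forall I, D.2 I <= 0) -> effective k D.
Proof.
move=> D0 le0; apply: (@effective_of_terms k n 0 [:: (1, [::])]) => //.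
- by move=> B u t; rewrite /termsum !big_seq1 !big_nil.
- by exists (fun=> 0); rewrite /termsum big_seq1 big_nil mulr1 rmorph1 oner_eq0.
by move=> I t; rewrite inE => /eqP->.
Qed.

(** The invariant form u_i - u_j defines the hyperplane through all the points other than p_i and
    p_j. *)
Lemma effective_deg1I (D : Pic n) (e : {set V}) : D.1 = 1 -> #|e| = 2%N ->
  (forall I, D.2 I <= [disjoint e & val I]%:Z) -> effective k D.
Proof.
move=> D1 /eqP/cards2P[i [j [ne_ij ->]]] leD.
apply: (@effective_of_terms k n 1 [:: (1, [:: i]); (-1, [:: j])]) => //.
- move=> B u t; rewrite /termsum !big_cons !big_nil rmorphN rmorph1; ring.
- exists (fun v => (v == i)%:R); rewrite /termsum !big_cons !big_nil eqxx.
  by rewrite [j == i]eq_sym (negPf ne_ij) mulr0n mul0r mulr0 !mulr1 !addr0 rmorph1 oner_eq0.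
move=> I t tL; apply: le_trans (leD I) _.
rewrite disjoints_subset subUset !sub1set !inE.
by move: tL; rewrite !inE => /orP[] /eqP->/=; case: (i \in _); case: (j \in _).
Qed.

(** Translation by t changes the form by t times the sum in the third hypothesis plus t^2 times the
    total weight. That third hypothesis is linear in [u], and its coefficient at each vertex is the
    sum of the weights there. *)
Lemma effective_of_edges (L : seq (k * (V * V))) (G : graph n) :
    loopfree G -> (forall t, t \in L -> [set t.2.1; t.2.2] \in G) ->
    (forall (R : comNzRingType) (c : {rmorphism k -> R}) (u : V -> R),
       \sum_(t <- L) c t.1 * (u t.2.1 + u t.2.2) = 0) ->
    \sum_(t <- L) t.1 = 0 ->
    (exists2 e0, e0 \in G & \sum_(t <- L | [set t.2.1; t.2.2] == e0) t.1 != 0) ->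
  effective k (D_graph G).
Proof.
move=> lfG LG tens total [e0 Ge0 nz0].
have LE (R : comNzRingType) (c : k -> R) u :
    termsum c [seq (t.1, [:: t.2.1; t.2.2]) | t <- L] u
    = \sum_(t <- L) c t.1 * (u t.2.1 * u t.2.2).
  rewrite /termsum big_map; apply: eq_bigr => t _.
  by rewrite big_cons big_seq1.
apply: (@effective_of_terms k n 2 [seq (t.1, [:: t.2.1; t.2.2]) | t <- L]) => //.
- by apply/allP=> t /mapP[t' _ ->].
- move=> B u t; rewrite !LE.
  rewrite (eq_bigr (fun r => (polyC \o in_alg B) r.1 * (u r.2.1 * u r.2.2) +
    (t * ((polyC \o in_alg B) r.1 * (u r.2.1 + u r.2.2)) + t ^+ 2 * (polyC \o in_alg B) r.1))).
    rewrite !big_split /= -!mulr_sumr (tens _ (polyC \o in_alg B)).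
    by rewrite -(rmorph_sum (polyC \o in_alg B)) total rmorph0 !mulr0 !addr0.
  by move=> r _; ring.
(* At the indicator of [e0] only the terms on that edge survive. *)
- exists (fun v => (v \in e0)%:R); rewrite LE.
  rewrite (_ : \sum_(t <- L) _ = (polyC \o in_alg k^o)
      (\sum_(t <- L | [set t.2.1; t.2.2] == e0) t.1)) ?fmorph_eq0 //.
  rewrite rmorph_sum [RHS]big_mkcond big_seq [RHS]big_seq; apply: eq_bigr => t tL.
  rewrite -natrM mulnb.
  have -> : (t.2.1 \in e0) && (t.2.2 \in e0) = ([set t.2.1; t.2.2] == e0).
    by rewrite eqEcard subUset !sub1set (lfG _ Ge0) (lfG _ (LG _ tL)) leqnn andbT.
  by case: eqP; rewrite ?mulr1 ?mulr0.
move=> I _ /mapP[t tL ->]; rewrite ffunE /= addn0.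
have Gt := LG _ tL; have le_max := @leq_bigmax_cond _ [in G] (fun e => #|val I :&: e|) _ Gt.
have c2 := lfG _ Gt.
have := cardsID (val I) [set t.2.1; t.2.2]; rewrite c2 setIC => cID.
rewrite lerBlDl -PoszD lez_nat -[X in (X <= _)%N]cID; apply: (leq_add le_max).
rewrite (@leq_trans #|[set v in [seq x <- [:: t.2.1; t.2.2] | x \notin val I]]|) //.
  apply/subset_leq_card/subsetP => v; rewrite !inE mem_filter !inE.
  by case/andP=> -> ->.
by rewrite cardsE (leq_trans (card_size _)) // size_filter /= addn0.
Qed.

Definition walk_terms (b : k) (g : nat -> V) l : seq (k * (V * V)) :=
  [seq (b * (-1) ^+ i, (g i, g i.+1)) | i <- index_iota 0 l].

(** Alternating weights cancel at each inner position of the walk, and only its two ends remain. *)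
Lemma sum_walk_terms (R : comNzRingType) (c : {rmorphism k -> R}) (u : V -> R) b g l :
  \sum_(t <- walk_terms b g l) c t.1 * (u t.2.1 + u t.2.2)
    = c b * (u (g 0%N) - (-1) ^+ l * u (g l)).
Proof.
rewrite big_map big_mkord /=.
elim: l => [|l IHl]; first by rewrite big_ord0 expr0 mul1r subrr mulr0.
rewrite big_ord_recr IHl /= rmorphM rmorphXn rmorphN1 exprS; ring.
Qed.

Lemma total_walk_terms b g l : \sum_(t <- walk_terms b g l) t.1 = b * (odd l)%:R.
Proof. by rewrite big_map big_mkord /= -mulr_sumr sum_sign. Qed.

(** Indices wrap round, so that the walk of length [size s] returns to its start. *)
Definition cyc_walk x0 (s : seq V) i := nth x0 s (i %% size s).

Lemma cyc_walk_edge x0 s i : uniq s -> (i < size s)%N ->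
  [set cyc_walk x0 s i; cyc_walk x0 s i.+1] = [set nth x0 s i; next s (nth x0 s i)].
Proof. by move=> Us lt_i; rewrite next_nth_mod // /cyc_walk modn_small. Qed.

Lemma cyc_terms_edges b x0 s t : uniq s ->
  t \in walk_terms b (cyc_walk x0 s) (size s) -> [set t.2.1; t.2.2] \in cyc_edges s.
Proof.
move=> Us /mapP[i]; rewrite mem_index_iota => /andP[_ lt_i] -> /=.
by rewrite cyc_walk_edge //; apply: imset_f; apply: mem_nth.
Qed.

(** Both ends of the walk are the head [x]: they cancel around an even cycle and add up to twice its
    variable around an odd one. *)
Lemma sum_cyc_terms (R : comNzRingType) (c : {rmorphism k -> R}) (u : V -> R) b x s :
  \sum_(t <- walk_terms b (cyc_walk x (x :: s)) (size (x :: s))) c t.1 * (u t.2.1 + u t.2.2)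
    = c b * (u x *+ (odd (size (x :: s))).*2).
Proof.
rewrite sum_walk_terms /cyc_walk modnn mod0n -signr_odd; case: odd => /=.
  by rewrite mulr2n; ring.
by rewrite expr0 mul1r subrr.
Qed.

Lemma cyc_terms_at0 b x s : uniq (x :: s) -> (3 <= size (x :: s))%N ->
  \sum_(t <- walk_terms b (cyc_walk x (x :: s)) (size (x :: s))
        | [set t.2.1; t.2.2] == [set x; next (x :: s) x]) t.1 = b.
Proof.
move=> Us sz; rewrite big_map big_mkord /= (bigD1 ord0) /=; last first.
  by rewrite cyc_walk_edge.
rewrite expr0 mulr1 big1 ?addr0 // => i /andP[/eqP Ei ne_i].
case/eqP: ne_i; apply: val_inj; apply/eqP => /=.
move: Ei; rewrite cyc_walk_edge // => /(cyc_edge_inj Us sz) Ei.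
rewrite -(nth_uniq x _ _ Us) //=; apply/eqP; apply: Ei; first exact: mem_nth.
by rewrite inE eqxx.
Qed.

Lemma cyc_edge_head (x : V) s : [set x; next (x :: s) x] \in cyc_edges (x :: s).
Proof. by apply: imset_f; rewrite inE eqxx. Qed.

Lemma polygon_at (C : graph n) (W : {set V}) m v : polygon C W m -> v \in W ->
  exists s, [/\ uniq (v :: s), size (v :: s) = m, (3 <= m)%N,
    W = [set x in v :: s] & C = cyc_edges (v :: s)].
Proof.
case/polygonP=> s [Us sz m3 -> ->]; rewrite inE => /rot_to[i s' Er].
exists s'; rewrite -Er rot_uniq size_rot cyc_edges_rot //; split=> //.
by apply/setP=> x; rewrite !inE mem_rot.
Qed.

Lemma sum_no_edge (L : seq (k * (V * V))) e0 :
    (forall t, t \in L -> [set t.2.1; t.2.2] != e0) ->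
  \sum_(t <- L | [set t.2.1; t.2.2] == e0) t.1 = 0.
Proof.
by move=> no; rewrite big_seq_cond big1 // => t /andP[/no/negPf->].
Qed.

Lemma cyc_edges_sub (s : seq V) e : e \in cyc_edges s -> e \subset s.
Proof.
case/imsetP=> x xs ->; apply/subsetP=> y /set2P[->//|->].
by rewrite mem_next.
Qed.

Lemma cyc_edge_nsub (s s' : seq V) x : uniq s -> (3 <= size s)%N -> x \in s ->
    (#|[set v in s] :&: [set v in s']| <= 1)%N ->
  forall e, e \in cyc_edges s' -> e != [set x; next s x].
Proof.
move=> Us sz xs le1 e /cyc_edges_sub sub; apply: contraTneq le1 => Ee.
rewrite -ltnNge (@leq_trans #|e|) //.
  by rewrite Ee cards2 eq_sym next1_neq // ltnW.
apply: subset_leq_card; apply/subsetP=> y ye; rewrite !inE (subsetP sub) // andbT.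
by move: ye; rewrite Ee => /set2P[->//|->]; rewrite mem_next.
Qed.

(** Weights alternate along each polygon. Two odd polygons get opposite weights at a common head;
    disjoint ones get equal weights in characteristic two, where the contribution 2 at each head is
    zero. *)
Lemma listed_effective (G : graph n) : loopfree G -> listed_type k G -> effective k (D_graph G).
Proof.
move=> lfG [].
- case=> W [m [ev m6 /polygonP[s [Us sz m3 _ EG]]]].
  case: s Us sz EG => [|x s] Us sz EG; first by rewrite -sz in m6.
  apply: (@effective_of_edges (walk_terms 1 (cyc_walk x (x :: s)) (size (x :: s)))) => //.
  + by move=> t /cyc_terms_edges; rewrite EG; apply.
  + by move=> R c u; rewrite sum_cyc_terms sz (negPf ev) mulr0n mulr0.
  + by rewrite total_walk_terms sz (negPf ev) mulr0.
  exists [set x; next (x :: s) x].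
    by rewrite EG cyc_edge_head.
  by rewrite cyc_terms_at0 ?sz // oner_eq0.
- case=> C1 [C2 [V1 [V2 [m1 [m2 [[o1 o2 P1 P2] [/eqP/cards1P[v Ev] EG]]]]]]].
  have /setIP[v1 v2] : v \in V1 :&: V2 by rewrite Ev set11.
  have [s1 [U1 sz1 m31 EV1 EC1]] := polygon_at P1 v1.
  have [s2 [U2 sz2 m32 EV2 EC2]] := polygon_at P2 v2.
  apply: (@effective_of_edges (walk_terms 1 (cyc_walk v (v :: s1)) (size (v :: s1)) ++
            walk_terms (-1) (cyc_walk v (v :: s2)) (size (v :: s2)))) => //.
  + move=> t; rewrite mem_cat EG EC1 EC2 in_setU => /orP[] /cyc_terms_edges-> //.
    by rewrite orbT.
  + move=> R c u; rewrite big_cat !sum_cyc_terms sz1 sz2 o1 o2 /= rmorphN; ring.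
  + by rewrite big_cat !total_walk_terms sz1 sz2 o1 o2 /=; ring.
  exists [set v; next (v :: s1) v].
    by rewrite EG EC1 in_setU cyc_edge_head.
  rewrite big_cat cyc_terms_at0 ?sz1 // sum_no_edge /= ?addr0 ?oner_eq0 // => t.
  move/(cyc_terms_edges U2); apply: (@cyc_edge_nsub (v :: s1) (v :: s2) v);
    rewrite ?sz1 ?inE ?eqxx //.
  by rewrite -EV1 -EV2 Ev cards1.
- case=> char2 [C1 [C2 [V1 [V2 [m1 [m2 [[o1 o2 P1 P2] [dis EG]]]]]]]].
  have two0 : 2%:R = 0 :> k by apply/eqP; move: char2; rewrite inE => /andP[].
  have /polygonP[[|x1 s1] [U1 sz1 m31 EV1 EC1]] := P1; first by rewrite -sz1 in m31.
  have /polygonP[[|x2 s2] [U2 sz2 m32 EV2 EC2]] := P2; first by rewrite -sz2 in m32.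
  apply: (@effective_of_edges (walk_terms 1 (cyc_walk x1 (x1 :: s1)) (size (x1 :: s1)) ++
            walk_terms 1 (cyc_walk x2 (x2 :: s2)) (size (x2 :: s2)))) => //.
  + move=> t; rewrite mem_cat EG EC1 EC2 in_setU => /orP[] /cyc_terms_edges-> //.
    by rewrite orbT.
  + move=> R c u; rewrite big_cat !sum_cyc_terms sz1 sz2 o1 o2 /=.
    rewrite -mulrDr -mulrnDl -mulr_natl -(rmorph_nat c) two0 rmorph0 mul0r mulr0 //.
  + by rewrite big_cat !total_walk_terms sz1 sz2 o1 o2 /= !mulr1.
  exists [set x1; next (x1 :: s1) x1].
    by rewrite EG EC1 in_setU cyc_edge_head.
  rewrite big_cat cyc_terms_at0 ?sz1 // sum_no_edge /= ?addr0 ?oner_eq0 // => t.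
  move/(cyc_terms_edges U2); apply: (@cyc_edge_nsub (x1 :: s1) (x2 :: s2) x1);
    rewrite ?sz1 ?inE ?eqxx //.
  by rewrite -EV1 -EV2 dis cards0.
case=> _ [C1 [C2 [V1 [V2 [m1 [m2 [[o1 o2 P1 P2] [dis]]]]]]]].
case=> l [g [[l1 g_inj g0 gl] [gi EG]]].
have [s1 [U1 sz1 m31 EV1 EC1]] := polygon_at P1 g0.
have [s2 [U2 sz2 m32 EV2 EC2]] := polygon_at P2 gl.
have gV1 i : (i < l)%N -> g i.+1 \notin V1.
  rewrite leq_eqVlt => /predU1P[->|lt_i].
    by apply/negP=> gV; have := in_set0 (g l); rewrite -dis inE gV gl.
  by have := gi i.+1 lt_i; rewrite inE negb_or => /andP[].
(* An odd cycle of weights +-1 contributes 2 at its head, which the path of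
   weights +-2 carries from one head to the other. *)
apply: (@effective_of_edges
          (walk_terms 1 (cyc_walk (g 0%N) (g 0%N :: s1)) (size (g 0%N :: s1)) ++
          (walk_terms (- (-1) ^+ l) (cyc_walk (g l) (g l :: s2)) (size (g l :: s2)) ++
           walk_terms (- 2) g l))) => //.
+ move=> t; rewrite !mem_cat EG EC1 EC2 !in_setU.
  case/or3P=> [/(cyc_terms_edges U1)-> //|/(cyc_terms_edges U2)->|].
    by rewrite ?orbT.
  move=> /mapP[i]; rewrite mem_index_iota => /andP[_ lt_i] -> /=; apply/orP; right.
  by apply/imsetP; exists (Ordinal lt_i).
+ move=> R c u; rewrite !big_cat !sum_cyc_terms sum_walk_terms sz1 sz2 o1 o2 /=.
  rewrite !rmorphN rmorphXn rmorphN1 rmorph1 rmorph_nat !mulr2n; ring.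
(* The total is 1 - (-1)^l - 2 for odd [l] and 1 - (-1)^l for even [l], zero in both cases. *)
+ rewrite !big_cat !total_walk_terms sz1 sz2 o1 o2 /= -signr_odd.
  by case: (odd l); rewrite ?expr1 ?expr0 ?mulr1n ?mulr0n; ring.
exists [set g 0%N; next (g 0%N :: s1) (g 0%N)].
  by rewrite EG EC1 !in_setU cyc_edge_head.
rewrite !big_cat cyc_terms_at0 ?sz1 // sum_no_edge /= ?add0r => [|t]; last first.
  move/(cyc_terms_edges U2); apply: (@cyc_edge_nsub (g 0%N :: s1) (g l :: s2) (g 0%N));
    rewrite ?sz1 ?inE ?eqxx //.
  by rewrite -EV1 -EV2 dis cards0.
(* Every path edge has an end outside the first polygon, so it is not the chosen edge. *)
rewrite sum_no_edge /= ?addr0 ?oner_eq0 // => t /mapP[i].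
rewrite mem_index_iota => /andP[_ lt_i] -> /=.
apply: contraNneq (gV1 _ lt_i) => Ee.
have /subsetP sub : [set g 0%N; next (g 0%N :: s1) (g 0%N)] \subset g 0%N :: s1.
  exact/cyc_edges_sub/cyc_edge_head.
by rewrite EV1 inE; apply: sub; rewrite -Ee set22.
Qed.

End Effective.

(** * Rigidity of the listed graphs *)

Section Rigid.
Variables (k : fieldType) (n : nat).
Local Notation V := 'I_n.-1.
Implicit Types (G : graph n) (w : {set V} -> k) (s : seq V).

(** This gives uniqueness up to a scalar: two flows that are not proportional would combine into a
    nonzero flow vanishing on an edge. *)
Definition rigid G := forall w, flow w -> (forall e, w e != 0 -> e \in G) ->
  (exists e, w e != 0) -> forall e, e \in G -> w e != 0.

Lemma rigid_of_edge G w e0 :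
    (forall e, w e != 0 -> e \in G) ->
    (forall e, e \in G -> (w e == 0) = (w e0 == 0)) ->
  (exists e, w e != 0) -> forall e, e \in G -> w e != 0.
Proof. by move=> wG Ew [e1 nz1] e eG; rewrite Ew // -(Ew e1) // wG. Qed.

Section OneCycle.
Variables (w : {set V} -> k) (v : V) (s : seq V).
Hypotheses (w_flow : flow w) (Us : uniq (v :: s)) (szs : (3 <= size (v :: s))%N).
Hypothesis only : forall x (e : {set V}), x \in s -> x \in e -> w e != 0 ->
  e \in cyc_edges (v :: s).
Let a := w [set v; next (v :: s) v].

Let alt i : (i < size (v :: s))%N ->
  w [set nth v (v :: s) i; next (v :: s) (nth v (v :: s) i)] = (-1) ^+ i * a.
Proof.
move: i; apply: cyc_edges_alternate => //.
  by move=> i _; case: w_flow => _ _; apply.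
by move=> [//|i] e /andP[_ lt_i]; apply: only; apply: mem_nth.
Qed.

(** The weights alternate from the head on, so they vanish together. Only the tail of the list is
    constrained by [only], which leaves the head [v] free for attachments. *)
Lemma cycle_edge_eq0 e : e \in cyc_edges (v :: s) -> (w e == 0) = (a == 0).
Proof.
case/imsetP=> x xs ->; rewrite -(nth_index v xs) alt ?index_mem //.
by rewrite mulf_eq0 signr_eq0.
Qed.

Hypothesis odd_s : odd (size (v :: s)).

Lemma sum_odd_cycle : \sum_(e in cyc_edges (v :: s)) w e = a.
Proof.
rewrite (sum_cyc_edges w v Us szs) (eq_bigr (fun i : 'I_(size (v :: s)) => (-1) ^+ i * a)).
  by rewrite -mulr_suml sum_sign odd_s mul1r.
by move=> i _; apply: alt.
Qed.

(** Since the cycle is odd, its first and last edges carry the same weight [a]; with the attached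
    edge they make up the vertex sum at [v]. *)
Lemma pendant_edge y : y \notin v :: s ->
    (forall e : {set V}, v \in e -> w e != 0 ->
       e \in cyc_edges (v :: s) \/ e = [set v; y]) ->
  a *+ 2 + w [set v; y] = 0.
Proof.
move=> ys onlyv; set u := last v s.
have us : u \in v :: s by apply: mem_last.
have Eu : next (v :: s) u = v.
  by rewrite /u (last_nth v) next_nth_mod //= modnn.
have wu : w [set u; v] = a.
  rewrite -{1}Eu /u (last_nth v) alt // -signr_odd.
  by move: odd_s => /= /negbTE ->; rewrite mul1r.
have vs : v \in v :: s by rewrite inE eqxx.
have ne_uv : u != v by rewrite -[X in _ != X]Eu eq_sym next1_neq // ltnW.
have Euv : [set u; v] = [set u; next (v :: s) u] by rewrite Eu.
have nyC : [set v; y] \notin cyc_edges (v :: s).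
  by apply: contra ys => /cyc_edges_sub/subsetP; apply; rewrite set22.
case: w_flow => _ _ /(_ v).
rewrite (@sum_incident _ _ w v [:: [set v; next (v :: s) v]; [set u; v]; [set v; y]]).
- by rewrite !big_cons big_nil addr0 wu addrA -mulr2n.
- rewrite /= !inE negb_or andbT -!andbA; apply/and3P; split.
  + rewrite Euv; apply/eqP => /(cyc_edge_inj Us szs vs us) Ev.
    by rewrite -Ev eqxx in ne_uv.
  + by apply: contraNneq nyC => <-; apply: cyc_edge_head.
  + by apply: contraNneq nyC => <-; rewrite Euv; apply: imset_f.
- by move=> e; rewrite !inE => /or3P[] /eqP ->; rewrite ?set21 ?set22.
move=> e ve nz; have [eC|->] := onlyv _ ve nz; last by rewrite !inE eqxx !orbT.
have := @cyc_edge_at _ _ u e Us eC; rewrite Eu => /(_ ve)[->|->];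
  by rewrite !inE eqxx ?orbT.
Qed.

End OneCycle.

(** Covers cycles sharing a vertex and disjoint ones alike: a common vertex has to be the head of
    both. Each odd cycle has total equal to its head weight, so the global sum makes the two head
    weights opposite. *)
Lemma two_cycles_rigid v1 s1 v2 s2 : uniq (v1 :: s1) -> uniq (v2 :: s2) ->
    (3 <= size (v1 :: s1))%N -> (3 <= size (v2 :: s2))%N ->
    odd (size (v1 :: s1)) -> odd (size (v2 :: s2)) ->
    (forall x, x \in v1 :: s1 -> x \in v2 :: s2 -> x = v1 /\ x = v2) ->
  rigid (cyc_edges (v1 :: s1) :|: cyc_edges (v2 :: s2)).
Proof.
move=> U1 U2 sz1 sz2 o1 o2 meet w w_flow wG.
have only1 x (e : {set V}) : x \in s1 -> x \in e -> w e != 0 -> e \in cyc_edges (v1 :: s1).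
  move=> xs xe /wG /setUP[//|/cyc_edges_sub/subsetP/(_ _ xe) xs2].
  have xs1 : x \in v1 :: s1 by rewrite inE xs orbT.
  by case: (meet x xs1 xs2) => Ex _; move: U1; rewrite /= -Ex xs.
have only2 x (e : {set V}) : x \in s2 -> x \in e -> w e != 0 -> e \in cyc_edges (v2 :: s2).
  move=> xs xe /wG /setUP[/cyc_edges_sub/subsetP/(_ _ xe) xs1|//].
  have xs2 : x \in v2 :: s2 by rewrite inE xs orbT.
  by case: (meet x xs1 xs2) => _ Ex; move: U2; rewrite /= -Ex xs.
have dis : [disjoint cyc_edges (v1 :: s1) & cyc_edges (v2 :: s2)].
  apply/pred0P=> e /=; apply/negbTE/andP=> -[/imsetP[x xs Ee] /cyc_edges_sub/subsetP sub].
  have ns : next (v1 :: s1) x \in v1 :: s1 by rewrite mem_next.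
  have [Ex _] : x = v1 /\ x = v2 by apply: meet => //; apply: sub; rewrite Ee set21.
  have nxe : next (v1 :: s1) x \in e by rewrite Ee set22.
  have [En _] := meet _ ns (sub _ nxe).
  by have := next1_neq U1 (ltnW sz1) xs; rewrite En Ex eqxx.
have E1 := cycle_edge_eq0 w_flow U1 sz1 only1.
have E2 := cycle_edge_eq0 w_flow U2 sz2 only2.
have ab : w [set v1; next (v1 :: s1) v1] = - w [set v2; next (v2 :: s2) v2].
  apply/eqP; rewrite -addr_eq0 -(sum_odd_cycle w_flow U1 sz1 only1 o1).
  rewrite -(sum_odd_cycle w_flow U2 sz2 only2 o2) -bigU //=.
  case: w_flow => _ total _; apply/eqP; rewrite -[RHS]total big_mkcond /=.
  by apply: eq_bigr => e _; case: ifP => // /negP eG;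
    apply/esym/eqP/negPn/negP => /wG; rewrite inE.
apply: (@rigid_of_edge _ w [set v1; next (v1 :: s1) v1]) => //.
by move=> e /setUP[/E1->//|/E2->]; rewrite ab oppr_eq0.
Qed.

(** Path weights alternate, and at each end twice the head weight of the polygon cancels the path
    edge. As 2 is invertible, all these weights vanish together. *)
Lemma barbell_rigid s1 s2 l (g : nat -> V) : 2%N \notin [pchar k] ->
    uniq (g 0%N :: s1) -> uniq (g l :: s2) ->
    (3 <= size (g 0%N :: s1))%N -> (3 <= size (g l :: s2))%N ->
    odd (size (g 0%N :: s1)) -> odd (size (g l :: s2)) ->
    (forall x, x \in g 0%N :: s1 -> x \notin g l :: s2) ->
    (0 < l)%N -> {in gtn l.+1 &, injective g} ->
    (forall i, (0 < i < l)%N -> (g i \notin g 0%N :: s1) && (g i \notin g l :: s2)) ->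
  rigid (cyc_edges (g 0%N :: s1) :|: cyc_edges (g l :: s2)
           :|: [set [set g (val i); g (val i).+1] | i : 'I_l]).
Proof.
move=> char2 U1 U2 sz1 sz2 o1 o2 dis l_gt0 g_inj gi w w_flow wG.
have n2 : 2%:R != 0 :> k by apply: contra char2 => two0; rewrite inE two0.
have gE i j : (i <= l)%N -> (j <= l)%N -> g i = g j -> i = j.
  by move=> li lj; apply: g_inj; rewrite inE ltnS.
have gV1 i : (0 < i <= l)%N -> g i \notin g 0%N :: s1.
  case/andP=> i0; rewrite leq_eqVlt => /predU1P[->|il].
    by apply/negP=> /dis; rewrite inE eqxx.
  by have /andP[] := gi i (introT andP (conj i0 il)).
have gV2 i : (i < l)%N -> g i \notin g l :: s2.
  case: i => [_|i il]; first by apply: dis; rewrite inE eqxx.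
  by have /andP[] := gi i.+1 il.
have wGP (e : {set V}) x : x \in e -> w e != 0 ->
    [\/ x \in g 0%N :: s1 /\ e \in cyc_edges (g 0%N :: s1),
        x \in g l :: s2 /\ e \in cyc_edges (g l :: s2) |
        exists2 i, (i < l)%N & e = [set g i; g i.+1]].
  move=> xe /wG/setUP[/setUP[eC|eC]|/imsetP[i _ Ee]].
  - by constructor 1; split=> //; apply: (subsetP (cyc_edges_sub eC)).
  - by constructor 2; split=> //; apply: (subsetP (cyc_edges_sub eC)).
  by constructor 3; exists i.
have only1 x (e : {set V}) : x \in s1 -> x \in e -> w e != 0 -> e \in cyc_edges (g 0%N :: s1).
  move=> xs xe nz; have xs1 : x \in g 0%N :: s1 by rewrite inE xs orbT.
  case: (wGP e x xe nz) => [[]//|[xs2 _]|[i il Ee]].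
    by rewrite (negPf (dis x xs1)) in xs2.
  move: xe; rewrite Ee => /set2P[] Ex; last first.
    by have := gV1 i.+1; rewrite -Ex xs1 il => /(_ isT).
  case: i il Ex {Ee} => [|i] il Ex; first by move: U1; rewrite /= -Ex xs.
  by have := gV1 i.+1; rewrite -Ex xs1 => /(_ (ltnW il)).
have only2 x (e : {set V}) : x \in s2 -> x \in e -> w e != 0 -> e \in cyc_edges (g l :: s2).
  move=> xs xe nz; have xs2 : x \in g l :: s2 by rewrite inE xs orbT.
  case: (wGP e x xe nz) => [[xs1 _]|[]//|[i il Ee]].
    by have := dis x xs1; rewrite xs2.
  move: xe; rewrite Ee => /set2P[] Ex; first by have := gV2 i il; rewrite -Ex xs2.
  move: il; rewrite leq_eqVlt => /predU1P[Ei|il]; last by have := gV2 _ il; rewrite -Ex xs2.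
  by move: U2; rewrite /= -Ei -Ex xs.
pose p i := w [set g i; g i.+1].
have pE i : (i < l)%N -> p i = (-1) ^+ i * p 0%N.
  elim: i => [|i IHi] il; first by rewrite mul1r.
  have il' := ltnW il; have := w_flow => -[_ _ /(_ (g i.+1))].
  rewrite (@sum_incident _ _ w _ [:: [set g i; g i.+1]; [set g i.+1; g i.+2]]).
  - rewrite !big_cons big_nil addr0 -!/(p _) IHi // exprS mulN1r mulNr addrC => /eqP.
    by rewrite addr_eq0 => /eqP.
  - rewrite /= inE andbT; apply/eqP=> /setP/(_ (g i)); rewrite set21 => /esym/set2P[] /gE Ei.
      by have := Ei (ltnW il') il' => /eqP; rewrite ltn_eqF.
    by have := Ei (ltnW il') il => /eqP; rewrite ltn_eqF.
  - by move=> e; rewrite !inE => /orP[] /eqP->; rewrite ?set21 ?set22.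
  move=> e xe nz; case: (wGP e _ xe nz) => [[xs1 _]|[xs2 _]|[j jl Ee]].
  - by have := gV1 i.+1; rewrite xs1 => /(_ (ltnW il)).
  - by have := gV2 _ il; rewrite xs2.
  move: xe; rewrite Ee => /set2P[] /gE Ei.
    by rewrite -(Ei il' (ltnW jl)) !inE eqxx orbT.
  by have [->] := Ei il' jl; rewrite !inE eqxx.
set a := w [set g 0%N; next (g 0%N :: s1) (g 0%N)].
set b := w [set g l; next (g l :: s2) (g l)].
have ap : a *+ 2 + p 0%N = 0.
  apply: (pendant_edge w_flow U1 sz1 only1 o1); first by apply: gV1.
  move=> e xe nz; case: (wGP e _ xe nz) => [[_]|[xs2 _]|[i il Ee]]; first by left.
    by have := gV2 _ l_gt0; rewrite xs2.
  right; move: xe; rewrite Ee => /set2P[] /gE Ei; last by have := Ei isT il.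
  by rewrite -(Ei isT (ltnW il)).
have bp : b *+ 2 + p l.-1 = 0.
  have lt_l : (l.-1 < l)%N by rewrite prednK.
  rewrite /p prednK // setUC.
  apply: (pendant_edge w_flow U2 sz2 only2 o2); first exact: gV2.
  move=> e xe nz; case: (wGP e _ xe nz) => [[xs1 _]|[_]|[i il Ee]]; [ | by left | ].
    by have := gV1 l; rewrite xs1 l_gt0 leqnn => /(_ isT).
  right; move: xe; rewrite Ee setUC => /set2P[] /gE Ei; last first.
    by have := Ei (leqnn _) (ltnW il) => /eqP; rewrite gtn_eqF.
  by rewrite (Ei (leqnn _) il).
have p0 : (p 0%N == 0) = (a == 0).
  move/eqP: ap; rewrite addrC addr_eq0 => /eqP ->.
  by rewrite oppr_eq0 -mulr_natl mulf_eq0 (negPf n2).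
have b0 : (b == 0) = (a == 0).
  rewrite -p0 -[RHS](_ : (p l.-1 == 0) = _); last first.
    by rewrite pE ?prednK // mulf_eq0 signr_eq0.
  move/eqP: bp; rewrite addrC addr_eq0 => /eqP ->.
  by rewrite oppr_eq0 -mulr_natl mulf_eq0 (negPf n2).
apply: (@rigid_of_edge _ w [set g 0%N; next (g 0%N :: s1) (g 0%N)]) => //.
move=> e /setUP[/setUP[]|/imsetP[i _ ->]].
- exact: (cycle_edge_eq0 w_flow U1 sz1 only1).
- by move/(cycle_edge_eq0 w_flow U2 sz2 only2)->; apply: b0.
by rewrite -[w _]/(p i) (pE i (ltn_ord i)) mulf_eq0 signr_eq0; apply: p0.
Qed.

Lemma listed_rigid G : listed_type k G -> rigid G.
Proof.
case.
- case=> W [m [ev m6 /polygonP[s [Us sz m3 _ ->]]]].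
  case: s Us sz => [|x s] Us sz; first by rewrite -sz in m6.
  move=> w w_flow wG.
  apply: (@rigid_of_edge _ w [set x; next (x :: s) x]) => // e.
  apply: cycle_edge_eq0 => //; first by rewrite sz.
  by move=> x' e' _ _; apply: wG.
- case=> C1 [C2 [V1 [V2 [m1 [m2 [[o1 o2 P1 P2] [/eqP/cards1P[v Ev] ->]]]]]]].
  have /setIP[v1 v2] : v \in V1 :&: V2 by rewrite Ev set11.
  have [s1 [U1 sz1 m31 EV1 ->]] := polygon_at P1 v1.
  have [s2 [U2 sz2 m32 EV2 ->]] := polygon_at P2 v2.
  apply: two_cycles_rigid; rewrite ?sz1 ?sz2 // => x x1 x2.
  suff /set1P -> : x \in [set v] by [].
  by rewrite -Ev EV1 EV2 inE !in_set x1.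
- case=> _ [C1 [C2 [V1 [V2 [m1 [m2 [[o1 o2 P1 P2] [dis ->]]]]]]]].
  have /polygonP[[|x1 s1] [U1 sz1 m31 EV1 ->]] := P1; first by rewrite -sz1 in m31.
  have /polygonP[[|x2 s2] [U2 sz2 m32 EV2 ->]] := P2; first by rewrite -sz2 in m32.
  apply: two_cycles_rigid; rewrite ?sz1 ?sz2 // => x xs1 xs2.
  suff : x \in set0 by rewrite inE.
  by rewrite -dis EV1 EV2 inE !in_set xs1.
case=> char2 [C1 [C2 [V1 [V2 [m1 [m2 [[o1 o2 P1 P2] [dis]]]]]]]].
case=> l [g [[l1 g_inj g0 gl] [gi ->]]].
have [s1 [U1 sz1 m31 EV1 ->]] := polygon_at P1 g0.
have [s2 [U2 sz2 m32 EV2 ->]] := polygon_at P2 gl.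
apply: barbell_rigid; rewrite ?sz1 ?sz2 //.
  move=> x xs1; apply/negP=> xs2; suff : x \in set0 by rewrite inE.
  by rewrite -dis EV1 EV2 inE !in_set xs1.
by move=> i /gi; rewrite in_setU negb_or EV1 EV2 !in_set.
Qed.

Lemma polygon_cover (C : graph n) (W : {set V}) m :
  polygon C W m -> W \subset cover C /\ #|W| = m.
Proof.
case/polygonP=> s [Us sz m3 -> ->]; split; last by rewrite cardsE (card_uniqP Us).
apply/subsetP=> x; rewrite inE => xs; apply/bigcupP; exists [set x; next s x].
  exact: imset_f.
exact: set21.
Qed.

Lemma coverS (G1 G2 : graph n) : G1 \subset G2 -> cover G1 \subset cover G2.
Proof.
move=> sub; apply/bigcupsP=> e eG; apply: bigcup_sup; exact: (subsetP sub).
Qed.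

(** Two polygons sharing at most one vertex have at least 3 + 3 - 1 vertices. The bound provides
    small index sets and excludes supports on four vertices. *)
Lemma listed_cover G : listed_type k G -> (5 <= #|cover G|)%N.
Proof.
have two (C1 C2 : graph n) (V1 V2 : {set V}) m1 m2 : C1 :|: C2 \subset G ->
    polygon C1 V1 m1 -> polygon C2 V2 m2 -> (#|V1 :&: V2| <= 1)%N -> (5 <= #|cover G|)%N.
  move=> sub P1 P2 le1; have [s1 c1] := polygon_cover P1; have [s2 c2] := polygon_cover P2.
  apply: (@leq_trans #|V1 :|: V2|).
    by rewrite cardsU c1 c2; case: P1 P2 => m13 _ [m23 _]; lia.
  apply: subset_leq_card; rewrite subUset.
  rewrite (subset_trans s1) ?(subset_trans s2) //; apply: coverS;
    by apply: subset_trans sub; rewrite ?subsetUl ?subsetUr.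
case.
- case=> W [m [_ m6 /polygon_cover[sub c]]].
  by rewrite (@leq_trans #|W|) ?subset_leq_card // c ltnW.
- case=> C1 [C2 [V1 [V2 [m1 [m2 [[_ _ P1 P2] [c1 EG]]]]]]].
  by apply: (two _ _ _ _ _ _ _ P1 P2); rewrite ?c1 // EG.
- case=> _ [C1 [C2 [V1 [V2 [m1 [m2 [[_ _ P1 P2] [dis EG]]]]]]]].
  by apply: (two _ _ _ _ _ _ _ P1 P2); rewrite ?dis ?cards0 // EG.
case=> _ [C1 [C2 [V1 [V2 [m1 [m2 [[_ _ P1 P2] [dis]]]]]]]].
case=> l [g [_ [_ EG]]].
by apply: (two _ _ _ _ _ _ _ P1 P2); rewrite ?dis ?cards0 // EG subsetUl.
Qed.

End Rigid.

(** * Irreducibility *)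

Lemma touch2 (T : finType) (x y : T) I :
  touch [set x; y] I = ((x \in I) + (y \in I))%N.
Proof.
rewrite /touch disjoints_subset !subUset !sub1set !inE.
by case: (x \in I); case: (y \in I).
Qed.

Lemma touch_card (T : finType) (e I : {set T}) : #|e| = 2%N -> touch e I = #|I :&: e|.
Proof.
move=> /eqP/cards2P[x [y [ne_xy ->]]]; rewrite touch2 setIUr cardsU.
have one z : #|I :&: [set z]| = (z \in I).
  have [zI|zI] := boolP (z \in I).
    by rewrite (setIidPr _) ?cards1 // sub1set.
  by apply/eqP; rewrite cards_eq0 setI_eq0 disjoint_sym disjoints1.
rewrite !one (_ : _ :&: _ = set0) ?cards0 ?subn0 //.
apply/setP=> z; rewrite !inE; apply/negbTE/negP=> /andP[/andP[_ /eqP->] /andP[_]].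
by apply/negP.
Qed.

(** The booleans tell which vertices of a square lie in [I]. The bounds from its four sides imply
    the one from the hyperplanes of its two diagonals. *)
Lemma square_bound (z : int) (a b c d : bool) :
    z <= 2 - (d + a)%N%:Z -> z <= 2 - (c + d)%N%:Z ->
    z <= 2 - (b + c)%N%:Z -> z <= 2 - (a + b)%N%:Z ->
  z <= (~~ a && ~~ c)%:Z + (~~ b && ~~ d)%:Z.
Proof. by case: a b c d => [] [] [] [] /=; lia. Qed.

Section Main.
Variables (k : fieldType) (n : nat) (n_gt1 : (1 < n)%N).
Local Notation V := 'I_n.-1.

Lemma pic_ext (D D' : Pic n) : D.1 = D'.1 -> (forall I, D.2 I = D'.2 I) -> D = D'.
Proof. by case: D D' => [d a] [d' a'] /= -> Ea; congr (_, _); apply/ffunP. Qed.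

Lemma picAddC (D D' : Pic n) : picAdd D D' = picAdd D' D.
Proof. by apply: pic_ext => [|I]; rewrite /= ?ffunE addrC. Qed.

Lemma le_D_graph (G : graph n) (I : EIdx n) (a : int) : a <= 2 ->
  (forall e, e \in G -> a <= 2 - #|val I :&: e|%:Z) -> a <= (D_graph G).2 I.
Proof.
move=> le2 leG; rewrite ffunE.
have Eb : (`|2 - a|%N%:Z = 2 - a)%R by rewrite gez0_abs // subr_ge0.
suff : (\max_(e in G) #|val I :&: e| <= `|2 - a|)%N.
  by rewrite -lez_nat Eb; move: (\max_(e in G) _)%N => M; lia.
apply/bigmax_leqP=> e /leG; rewrite -lez_nat Eb; move: #|_| => M; lia.
Qed.

(** Subtracting the hyperplane class of [e1] leaves a class dominated by that of [e2], which is
    therefore effective; both have degree one, hence are nonzero. *)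
Lemma reducible_two_lines (D : Pic n) (e1 e2 : {set V}) :
    D.1 = 2 -> #|e1| = 2%N -> #|e2| = 2%N ->
    (forall I, D.2 I <= [disjoint e1 & val I]%:Z + [disjoint e2 & val I]%:Z) ->
  ~ irreducible_eff k D.
Proof.
move=> D2 c1 c2 leD [_ _ irr].
pose D1 : Pic n := (1, [ffun I : EIdx n => [disjoint e1 & val I]%:Z]).
pose D2' : Pic n := (1, [ffun I : EIdx n => D.2 I - [disjoint e1 & val I]%:Z]).
have [||||] // := irr D1 D2'.
- by apply: (@effective_deg1I k n n_gt1 D1 e1) => // I; rewrite ffunE.
- by apply: (@effective_deg1I k n n_gt1 D2' e2) => // I; rewrite ffunE lerBlDl.
by apply: pic_ext => [|I]; [rewrite D2 | rewrite /= !ffunE addrC subrK].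
Qed.

(** If every edge of nonzero weight contained [x], the sum at [x] would be the total, which is zero,
    and the loop would have weight zero. *)
Lemma balanced_loop (w : {set V} -> k) x : balanced w -> w [set x] != 0 ->
  exists2 e : {set V}, x \notin e & w e != 0.
Proof.
case=> _ total tens nz; apply/exists_inP; apply: contraNT nz => /exists_inPn all_x.
have := tens x; rewrite (_ : \sum_(e | _) _ = 0) ?add0r; first by move->.
rewrite -[RHS]total big_mkcond /=; apply: eq_bigr => e _.
by case: ifPn => // /all_x; rewrite negbK => /eqP.
Qed.

Lemma balanced_flow (w : {set V} -> k) :
  balanced w -> (forall x, w [set x] = 0) -> flow w.
Proof.
case=> w2 total tens w1; split=> // [e nz|x]; last by have := tens x; rewrite w1 addr0.
have := w2 e nz; case/andP; rewrite leq_eqVlt => /predU1P[c1 _|c2 c2'].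
  by have /eqP/cards1P[x Ee] := esym c1; rewrite Ee w1 eqxx in nz.
by apply/eqP; rewrite eqn_leq c2 c2'.
Qed.

Lemma balanced_edge (w : {set V} -> k) e :
  balanced w -> w e != 0 -> exists i j, e = [set i; j].
Proof.
case=> w2 _ _ /w2/andP[]; rewrite leq_eqVlt => /predU1P[/esym/eqP/cards1P[x ->] _|c2 c2'].
  by exists x, x; rewrite setUid.
have /cards2P[x [y [_ ->]]] : #|e| == 2%N by rewrite eqn_leq c2 c2'.
by exists x, y.
Qed.

Lemma irreducible_listed (D : Pic n) : D.1 = 2 -> irreducible_eff k D ->
  exists G : graph n, [/\ loopfree G, D = D_graph G & listed_type k G].
Proof.
move=> D2 irrD; have [effD _ irr] := irrD.
have [w [bal nzw] leD] := effective_deg2 n_gt1 effD D2.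
have [x|/existsPn w1] := boolP [exists x, w [set x] != 0].
  (* A loop at [x] and an edge or loop ij avoiding [x] bound [D] by the hyperplane classes of xi and
     xj. *)
  case/existsP: x => x nzx; have [e xe nze] := balanced_loop bal nzx.
  have [i [j Ee]] := balanced_edge bal nze.
  move: xe; rewrite Ee !inE negb_or => /andP[ne_xi ne_xj].
  case: (@reducible_two_lines D [set x; i] [set x; j]) => //; rewrite ?cards2 ?ne_xi ?ne_xj //.
  move=> I; have := leD _ I nzx; have := leD _ I nze.
  rewrite Ee -[[set x]]setUid !touch2 !disjoints_subset !subUset !sub1set !inE.
  by case: (x \in _); case: (i \in _); case: (j \in _) => /=; lia.
have fl : flow w.
  by apply: balanced_flow => // x; apply/eqP/negPn/w1.
have [[a [b [c [d [Uabcd [h1 h2 h3 h4]]]]]]|[G GP typG]] := flow_subgraph fl nzw.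
  move: Uabcd; rewrite /= !inE !negb_or -!andbA.
  case/and5P=> ne_ab ne_ac ne_ad ne_bc /and3P[ne_bd ne_cd _].
  case: (@reducible_two_lines D [set a; c] [set b; d]) => //; rewrite ?cards2 ?ne_ac ?ne_bd //.
  move=> I; have := leD _ I h1; have := leD _ I h2; have := leD _ I h3; have := leD _ I h4.
  rewrite !touch2 !disjoints_subset !subUset !sub1set !inE.
  exact: square_bound.
have lfG : loopfree G by move=> e /GP nz; case: fl => w2 _ _; apply: w2.
exists G; split=> //.
have le2 I : D.2 I <= 2.
  by have [e nz] := nzw; have := leD e I nz; move: (touch _ _) => m; lia.
have leG I : D.2 I <= (D_graph G).2 I.
  apply: le_D_graph => // e eG; rewrite -touch_card; last exact: lfG.
  by apply: leD; apply: GP.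
(* The difference is a sum of exceptional classes with nonnegative multiplicities, hence effective;
   irreducibility makes it zero. *)
pose E : Pic n := (0, [ffun I : EIdx n => D.2 I - (D_graph G).2 I]).
have [||||E0] // := irr (D_graph G) E.
- exact: listed_effective.
- by apply: effective_deg0I => // I; rewrite ffunE subr_le0.
- by apply: pic_ext => [|I]; [rewrite D2 | rewrite /= !ffunE addrC subrK].
apply: pic_ext => // I; apply/eqP; rewrite -subr_eq0.
by have := congr1 (fun D' : Pic n => D'.2 I) E0; rewrite /= !ffunE => ->.
Qed.

(** * Irreducibility of the listed classes *)

Section Listed.
Variable G : graph n.
Hypotheses (lfG : loopfree G) (typG : listed_type k G).

(** With at least five points in a listed graph, [EIdx] contains all sets of one or two points. *)
Let n_ge6 : (2 <= n - 4)%N.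
Proof.
have := leq_trans (listed_cover typG) (max_card _); rewrite card_ord; lia.
Qed.

Let EIdx_of (I : {set V}) : (0 < #|I| <= 2)%N -> exists J : EIdx n, val J = I.
Proof.
case/andP=> I0 I2; have PI : ((0 < #|I|) && (#|I| <= n - 4))%N by rewrite I0 (leq_trans I2).
by exists (Sub I PI); rewrite SubK.
Qed.

Let D_graph1 (I : EIdx n) x : val I = [set x] -> 0 < (D_graph G).2 I.
Proof.
move=> EI; suff : 1 <= (D_graph G).2 I by apply: lt_le_trans.
apply: le_D_graph => // e _; rewrite lerBrDl -lerBrDr lez_nat EI.
by rewrite (leq_trans (subset_leq_card (subsetIl _ _))) ?cards1.
Qed.

(** An edge of [G] different from [e] meets [e] in at most one point. *)
Let D_graph2 (I : EIdx n) (e : {set V}) :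
  #|e| = 2%N -> val I = e -> (D_graph G).2 I <= 0 -> e \in G.
Proof.
move=> c2 EI; apply: contraLR => eG; rewrite -ltNge.
suff : 1 <= (D_graph G).2 I by apply: lt_le_trans.
apply: le_D_graph => // e' eG'; rewrite lerBrDl -lerBrDr lez_nat EI.
rewrite -ltnS -[X in (_ < X)%N]c2 proper_card // properEneq subsetIl andbT.
apply: contraNneq eG => /setIidPl sub.
suff -> : e = e' by [].
by apply/eqP; rewrite eqEcard sub c2 lfG.
Qed.

(** Coefficients of [D1] are at most zero, so those of [D_graph G] are bounded by those of [D2].
    One- and two-point sets then force the weights of [D2] to be a flow supported in [G]; by
    rigidity its support is all of [G], which gives the reverse bound. *)
Lemma listed_deg02 (D1 D2 : Pic n) : effective k D1 -> effective k D2 ->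
  D1.1 = 0 -> D2.1 = 2 -> D_graph G = picAdd D1 D2 -> D1 = pic0 n.
Proof.
move=> eff1 eff2 d1 d2 ED.
have le1 I := effective_deg0 I eff1 d1.
have ED2 I : (D_graph G).2 I = D1.2 I + D2.2 I by rewrite ED /= ffunE.
have [w [bal nzw] leD] := effective_deg2 n_gt1 eff2 d2.
have le_touch e I : w e != 0 -> (D_graph G).2 I <= 2 - (touch e (val I))%:Z.
  by move=> nz; rewrite ED2 -[leRHS]add0r lerD ?leD.
have w1 x : w [set x] = 0.
  apply/eqP; apply: contraTT isT => nz.
  have [I EI] : exists J : EIdx n, val J = [set x] by apply: EIdx_of; rewrite cards1.
  have := le_touch _ I nz; rewrite EI -[[set x]]setUid touch2 setUid set11 /=.
  by rewrite subrr leNgt (D_graph1 EI).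
have fl := balanced_flow bal w1.
have wG e : w e != 0 -> e \in G.
  move=> nz; have c2 : #|e| = 2%N by case: fl => w2 _ _; apply: w2.
  have [I EI] : exists J : EIdx n, val J = e by apply: EIdx_of; rewrite c2.
  by apply: (@D_graph2 I) => //; have := le_touch _ I nz; rewrite touch_card // EI setIid c2.
have full := listed_rigid typG fl wG nzw.
apply: pic_ext => // I; rewrite ffunE; apply/le_anti; rewrite le1 /=.
have : D2.2 I <= (D_graph G).2 I.
  apply: le_D_graph => [|e eG].
    by have [e nz] := nzw; have := leD e I nz; move: (touch _ _) => m; lia.
  by rewrite -touch_card; [apply/leD/full | apply: lfG].
by rewrite ED2 -[leLHS]add0r lerD2r.
Qed.

Lemma sum_indicator (T : finType) (P : pred T) (e0 : T) :
  \sum_(e | P e) (e == e0)%:R = (P e0)%:R :> k.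
Proof.
rewrite big_mkcond (bigD1 e0) //= eqxx big1 ?addr0 => [|e /negPf->]; last by case: ifP.
by case: (P e0).
Qed.

(** One-point sets show that the pairs of the two hyperplanes are disjoint, two-point sets that the
    square between them lies in [G]. Alternating weights on the square would then have full support,
    against the five vertices of [G]. *)
Lemma listed_deg11 (D1 D2 : Pic n) : effective k D1 -> effective k D2 ->
  D1.1 = 1 -> D2.1 = 1 -> D_graph G <> picAdd D1 D2.
Proof.
move=> eff1 eff2 d1 d2 ED.
have [e1 c1 le1] := effective_deg1 n_gt1 eff1 d1.
have [e2 c2 le2] := effective_deg1 n_gt1 eff2 d2.
have leD I : (D_graph G).2 I <= [disjoint e1 & val I]%:Z + [disjoint e2 & val I]%:Z.
  by rewrite ED ffunE lerD.
have ne x y : x \in e1 -> y \in e2 -> x != y.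
  move=> x1 y2; apply/eqP=> Exy; rewrite -Exy in y2.
  have [I EI] : exists J : EIdx n, val J = [set x] by apply: EIdx_of; rewrite cards1.
  have := leD I; rewrite EI ![[disjoint _ & [set x]]]disjoint_sym !disjoints1 x1 y2 /=.
  by rewrite addr0 leNgt (D_graph1 EI).
have inG x y : x \in e1 -> y \in e2 -> [set x; y] \in G.
  move=> x1 y2; have ne_xy := ne x y x1 y2.
  have c2' : #|[set x; y]| = 2%N by rewrite cards2 ne_xy.
  have [I EI] : exists J : EIdx n, val J = [set x; y] by apply: EIdx_of; rewrite c2'.
  apply: (@D_graph2 I) => //; have := leD I; rewrite EI.
  rewrite ![[disjoint _ & [set x; y]]]disjoint_sym !disjoints_subset !subUset !sub1set !inE.
  by rewrite x1 y2 /= andbF.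
have /eqP/cards2P[a [c [ne_ac E1]]] := c1.
have /eqP/cards2P[b [d [ne_bd E2]]] := c2.
have [a1 c1' b2 d2'] : [/\ a \in e1, c \in e1, b \in e2 & d \in e2].
  by rewrite E1 E2 !set21 !set22.
have [ne_ab ne_ad ne_cb ne_cd] : [/\ a != b, a != d, c != b & c != d] by split; apply: ne.
(* Alternating signs around the square a, b, c, d. *)
pose w (e : {set V}) : k := (e == [set a; b])%:R - (e == [set c; b])%:R
   + (e == [set c; d])%:R - (e == [set a; d])%:R.
have w_supp e : w e != 0 ->
    [\/ e = [set a; b], e = [set c; b], e = [set c; d] | e = [set a; d]].
  rewrite /w; case: (e =P [set a; b]) => [|_]; first by constructor 1.
  case: (e =P [set c; b]) => [|_]; first by constructor 2.
  case: (e =P [set c; d]) => [|_]; first by constructor 3.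
  case: (e =P [set a; d]) => [|_]; first by constructor 4.
  by rewrite /= !subr0 addr0 eqxx.
have wG e : w e != 0 -> e \in G by case/w_supp=> ->; apply: inG.
have fl : flow w.
  split=> [e /wG /lfG //||x].
    by rewrite !sumrB big_split sumrB /= !sum_indicator /=; ring.
  rewrite !sumrB big_split sumrB /= !sum_indicator !inE.
  have [->|_] := eqVneq x a; first by rewrite (negPf ne_ab) (negPf ne_ac) (negPf ne_ad) /=; ring.
  have [->|_] := eqVneq x c; first by rewrite (negPf ne_cb) (negPf ne_cd) /=; ring.
  by case: (x == b); case: (x == d) => /=; ring.
have nz : exists e, w e != 0.
  exists [set a; b]; rewrite /w eqxx.
  have -> : ([set a; b] == [set c; b]) = false.
    by apply/eqP=> /setP/(_ a); rewrite !inE eqxx (negPf ne_ac) (negPf ne_ab).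
  have -> : ([set a; b] == [set c; d]) = false.
    by apply/eqP=> /setP/(_ a); rewrite !inE eqxx (negPf ne_ac) (negPf ne_ad).
  have -> : ([set a; b] == [set a; d]) = false.
    by apply/eqP=> /setP/(_ b); rewrite !inE eqxx orbT eq_sym (negPf ne_ab) (negPf ne_bd).
  by rewrite !mulr0n !subr0 addr0 oner_eq0.
have full := listed_rigid typG fl wG nz.
have := listed_cover typG; apply/negP; rewrite -ltnNge ltnS.
apply: (@leq_trans #|[set a; c] :|: [set b; d]|); last first.
  by rewrite (leq_trans (leq_card_setU _ _)) // !cards2 ne_ac ne_bd.
apply: subset_leq_card; apply/bigcupsP=> e /full/w_supp[] ->;
  by rewrite subUset !sub1set !inE !eqxx ?orbT.
Qed.

Lemma listed_irreducible : irreducible_eff k (D_graph G).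
Proof.
split; [exact: listed_effective | by case | move=> D1 D2 eff1 eff2 ED].
have [d1 [_ [Ed1 _ _]]] := eff1; have [d2 [_ [Ed2 _ _]]] := eff2.
have Ed : (d1 + d2 = 2)%N.
  by have := congr1 fst ED; rewrite /= Ed1 Ed2 => -[].
case: d1 d2 Ed Ed1 Ed2 => [|[|[|]]] [|[|[|]]] // _ Ed1 Ed2.
- by left; apply: (listed_deg02 eff1 eff2).
- by case: (listed_deg11 eff1 eff2 Ed1 Ed2).
by right; apply: (listed_deg02 eff2 eff1) => //; rewrite picAddC.
Qed.

End Listed.
End Main.

Theorem mainTheorem14 (k : fieldType) (n : nat) (hn : (5 <= n)%N) (D : Pic n)
    (hdeg : picDeg D = 2) :
  irreducible_eff k D <->
  exists G : graph n,
    [/\ loopfree G, D = D_graph G &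
        [\/ type1 G, type2 G,
            (2%N \in [pchar k])%R /\ type3a G |
            (2%N \notin [pchar k])%R /\ type3b G]].
Proof.
have n_gt1 : (1 < n)%N by apply: leq_trans hn.
split; first exact: irreducible_listed.
by case=> G [lfG -> typG]; apply: listed_irreducible.
Qed.
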